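(* Let $\mu$ be a nonnegative Radon measure on $\mathbb R^d$ and let $W:\mathbb R^d\to\mathrm{Gr}(d)$ be a $\mu$-measurable map such that every Lipschitz function $u:\mathbb R^d\to\mathbb R$ is differentiable at $\mu$-a.e. $x$ with respect to $W(x)$. Then $W(x)\subset T_\mu(x)$ for $\mu$-a.e. $x$.
   Context: $\mathrm{Gr}(d)$ is the set of all linear subspaces of $\mathbb R^d$ (of any dimension). A function $u:\mathbb R^d\to\mathbb R$ is differentiable at $x$ with respect to a linear subspace $W\subset\mathbb R^d$ if there is a linear form $L$ on $W$ with $u(x+v)-u(x)=L(v)+o(|v|)$ as $W\ni v\to0$. $\mathcal D(\mathbb R^d)$ is the space of smooth compactly supported functions; $\operatorname{Lip}_1(\mathbb R^d)$ the real $1$-Lipschitz functions. Let $\mathcal M_{0,1}(\mathbb R^d)$ be the finite signed Borel measures $f$ with $\int df=0$ and $\int|x|\,d|f|<\infty$, with norm $\|f\|_{\mathrm{KR}}=\sup\{\int u\,df: u\in\operatorname{Lip}_1(\mathbb R^d)\}$. The Arens-Eells space $\mathrm{AE}(\mathbb R^d)$ is the completion of $\mathcal M_{0,1}(\mathbb R^d)$ for this norm, identified with a subspace of distributions: $f\in\mathcal D'(\mathbb R^d)$ belongs to $\mathrm{AE}(\mathbb R^d)$ iff $\langle f,\varphi_n\rangle\to0$ for every sequence $(\varphi_n)\subset\mathcal D(\mathbb R^d)$ with $\sup_n\|\nabla\varphi_n\|_\infty<\infty$ and $\varphi_n\to c$ pointwise for some constant $c\in\mathbb R$. For a nonnegative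 Radon measure $\mu$, set $\mathcal T_\mu:=\{\sigma\in(L^1_\mu(\mathbb R^d))^d: -\operatorname{div}(\sigma\mu)\in\mathrm{AE}(\mathbb R^d)\}$. There is a $\mu$-measurable map $x\mapsto T_\mu(x)$ valued in the linear subspaces of $\mathbb R^d$, unique up to $\mu$-null sets, such that for $\sigma\in(L^1_\mu)^d$: $\sigma\in\mathcal T_\mu\iff\sigma(x)\in T_\mu(x)$ $\mu$-a.e. (the MK tangent bundle). *)

(* Defs.v *)
From HB Require Import structures.
From mathcomp Require Import all_boot all_order all_algebra.
From mathcomp Require Import all_classical all_reals all_analysis.

Set Implicit Arguments.
Unset Strict Implicit.
Unset Printing Implicit Defensive.

Import Order.TTheory GRing.Theory Num.Theory.
Import numFieldNormedType.Exports.

Local Open Scope classical_set_scope.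
Local Open Scope ring_scope.

(* R^d is 'rV[R]_d with the library (sup) norm. The norm is used below only
   through o(|v|), Lipschitz continuity with an unspecified constant,
   boundedness of gradients and the topology of the Grassmannian, none of which
   changes if it is replaced by the equivalent Euclidean norm. *)

Notation borel_rV R d := (g_sigma_algebraType (@open 'rV[R]_d)).

Section Defs.
Context {R : realType} {d : nat}.
Implicit Types (u phi : 'rV[R]_d -> R) (mu : {measure set (borel_rV R d) -> \bar R}).

Definition radon mu : Prop :=
  (forall K : set 'rV[R]_d, compact K -> (mu K < +oo)%E) /\
  (forall A : set (borel_rV R d), measurable A ->
     mu A = ereal_sup [set mu K | K in [set K : set 'rV[R]_d | compact K /\ K `<=` A]]).

(* Membership in the completion by mu of the Borel sigma-algebra. *)
Definition mu_measurable mu (A : set (borel_rV R d)) : Prop :=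
  exists2 B : set (borel_rV R d), measurable B & mu.-negligible (A `+` B).

(* Gr(d) is {vspace 'rV[R]_d}, with the topology of the distance
   max (delta V V') (delta V' V), where delta V V' is the least e such that
   every v in V has some v' in V' with |v - v'| <= e |v|. *)
Definition gr_close (e : R) (V V' : {vspace 'rV[R]_d}) : Prop :=
  (forall v, v \in V -> exists2 v', v' \in V' & `|v - v'| <= e * `|v|) /\
  (forall v', v' \in V' -> exists2 v, v \in V & `|v' - v| <= e * `|v'|).

Definition gr_open (U : set {vspace 'rV[R]_d}) : Prop :=
  forall V, U V -> exists2 e : R, 0 < e & forall V', gr_close e V V' -> U V'.

Definition gr_measurable mu (W : 'rV[R]_d -> {vspace 'rV[R]_d}) : Prop :=
  forall U, gr_open U -> mu_measurable mu (W @^-1` U).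

Definition differentiable_along u (x : 'rV[R]_d) (W : {vspace 'rV[R]_d}) : Prop :=
  exists L : {scalar subvs_of W},
    forall e : R, 0 < e -> exists2 r : R, 0 < r &
      forall v : subvs_of W, `|vsval v| < r ->
        `|u (x + vsval v) - u x - L v| <= e * `|vsval v|.

Definition partial (i : 'I_d) u : 'rV[R]_d -> R :=
  fun x => 'D_(delta_mx 0 i) u x.

Definition grad u (x : 'rV[R]_d) : 'rV[R]_d := \row_i partial i u x.

Fixpoint Ck (k : nat) u : Prop :=
  continuous u /\
  if k is k'.+1 then
    forall i : 'I_d,
      (forall x, derivable u x (delta_mx 0 i)) /\ Ck k' (partial i u)
  else True.

Definition supp u : set 'rV[R]_d := closure [set x | u x != 0].

Definition test_function phi : Prop :=
  (forall k, Ck k phi) /\ compact (supp phi).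

(* A distribution is represented by a functional on all functions, of which
   only the values on test functions matter. Multi-indices of order <= N are
   sequences of at most N coordinates, and S plays the role of
   sup_{|alpha| <= N} ||d^alpha phi||_oo. *)
Definition distribution (f : ('rV[R]_d -> R) -> R) : Prop :=
  (forall (a : R) phi psi, test_function phi -> test_function psi ->
     f (fun x => a * phi x + psi x) = a * f phi + f psi) /\
  (forall K : set 'rV[R]_d, compact K ->
     exists (N : nat) (C : R), forall phi (S : R),
       test_function phi -> supp phi `<=` K ->
       (forall (s : seq 'I_d) x, (size s <= N)%N -> `|foldr partial phi s x| <= S) ->
       `|f phi| <= C * S).

Definition arens_eells (f : ('rV[R]_d -> R) -> R) : Prop :=
  distribution f /\
  forall phi : nat -> 'rV[R]_d -> R,
    (forall n, test_function (phi n)) ->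
    (exists C : R, forall n x, `|grad (phi n) x| <= C) ->
    (exists c : R, forall x, phi n x @[n --> \oo] --> c) ->
    f (phi n) @[n --> \oo] --> (0 : R).

Definition L1_field mu (sigma : 'rV[R]_d -> 'rV[R]_d) : Prop :=
  forall i : 'I_d, mu.-integrable setT (fun x : borel_rV R d => (sigma x 0 i)%:E).

(* - div (sigma mu) as a distribution: phi |-> \int sigma . grad phi dmu. *)
Definition opp_div mu (sigma : 'rV[R]_d -> 'rV[R]_d) phi : R :=
  \int[mu]_x (\sum_(i < d) sigma x 0 i * grad phi x 0 i).

Definition tangent_field mu (sigma : 'rV[R]_d -> 'rV[R]_d) : Prop :=
  L1_field mu sigma /\ arens_eells (opp_div mu sigma).

(* These properties determine T up to mu-null sets. *)
Definition MK_tangent_bundle mu (T : 'rV[R]_d -> {vspace 'rV[R]_d}) : Prop :=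
  gr_measurable mu T /\
  forall sigma, L1_field mu sigma ->
    (tangent_field mu sigma <-> {ae mu, forall x, sigma x \in T x}).

End Defs.

(* Main.v *)
Require Import Defs.
From HB Require Import structures.
From mathcomp Require Import all_boot all_order all_algebra.
From mathcomp Require Import all_classical all_reals all_analysis.
From mathcomp Require Import measurable_realfun.
From mathcomp Require Import ring lra.
Import Order.TTheory GRing.Theory Num.Theory.
Import numFieldNormedType.Exports.
Set Implicit Arguments.
Unset Strict Implicit.
Unset Printing Implicit Defensive.
Local Open Scope classical_set_scope.
Local Open Scope ring_scope.

(** Write [P_x] for the orthogonal projection onto [W x]. The fields [P_x e_i],
cut off to a ball and modified on a null set, are Borel, bounded and integrable,
and they span [W x]. So it suffices that every such field [sigma] is tangent:
then its values lie in [T x] almost everywhere, by the characterization of [T].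
Tangency means that the integral of [sigma . grad phi_n] tends to [0] whenever
the [phi_n] have bounded gradients and converge pointwise to a constant. As the
convergence is uniform on balls, this follows from a closability statement
([flux_small]): functions with bounded slope that are uniformly small on a ball
have a small flux through [sigma].

Suppose that closability fails: arbitrarily small functions have flux at least
[eps]. These functions form convex sets, so by the parallelogram identity almost
minimizers [f_j] of the integral of [|grad f|^2] over the ball have gradients
that form a Cauchy sequence in mean square ([almost_minimizers_close]), as fast
as one likes. Hence on a set of positive measure, called exceptional below, the
gradients of all the [f_j] are close to each other and their slopes along
[sigma x] are bounded below.

The [f_j] can be chosen one after the other, each of them tiny compared with the
scale at which its predecessors look affine. Consider then the function
[u = sum_k w_k (f_2k - f_(2k+1))]. On the exceptional set its layers have small
gradients, since the gradients of the [f_j] are close together. However, at a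
scale where [f_2k] is resolved and [f_(2k+1)] is still negligible, the
difference quotient of [u] along [sigma x] sees the full slope of [f_2k], while
at a scale where both are resolved, or both negligible, it sees almost nothing.
So the quotients oscillate, and [u] has no derivative at [x] along [sigma x],
which lies in [W x] ([osc_not_differentiable]). Off the exceptional set the
gradients of the layers may be of size one, and the weights
[w_k = prod_(i < k) (1 - |grad (f_2i - f_(2i+1))|)], up to a cutoff that restricts
the construction to a ball, keep [u] Lipschitz, because
[sum_k w_k |grad (f_2k - f_(2k+1))|] telescopes and is at most one
([weight_grad1_sum]). This contradicts the hypothesis on [W].

Two devices keep the construction elementary. The weights are only Lipschitz
functions, so the Lipschitz constant of [u] is estimated locally at each point
and then propagated along segments ([lipschitz_of_locally]). The exceptional set
is handled by integrating an almost everywhere inequality between the flux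
density and a series that penalizes distant gradients
([flux_density_le_excess]). *)

(** * Calculus with partial derivatives *)

Section Calculus.
Context {R : realType} {d : nat}.
Implicit Types (f g u : 'rV[R]_d -> R) (x y z v : 'rV[R]_d).

Lemma sum_half_powers n : \sum_(k < n) (2^-1 : R) ^+ k <= 2.
Proof.
have -> : \sum_(k < n) (2^-1 : R) ^+ k = 2 - 2 * 2^-1 ^+ n.
  elim: n => [|n IH]; first by rewrite big_ord0 expr0; lra.
  by rewrite big_ord_recr/= IH exprS; field.
by rewrite gerBl mulr_ge0// exprn_ge0// invr_ge0.
Qed.

Lemma coord_le_norm v i : `|v 0 i| <= `|v|.
Proof.
rewrite [leRHS]/Num.Def.normr /= mx_normrE; apply/bigmax_geP; right => /=.
by exists (0, i).
Qed.

Lemma norm_le_coord v (r : R) :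
  0 <= r -> (forall i, `|v 0 i| <= r) -> `|v| <= r.
Proof.
move=> r0 vr; rewrite [leLHS]/Num.Def.normr /= mx_normrE; apply/bigmax_leP; split => //.
by move=> [i j] _ /=; rewrite ord1.
Qed.

Lemma is_derive_line f z (i : 'I_d) (s : R) :
  derivable f (z + s *: delta_mx 0 i) (delta_mx 0 i) ->
  is_derive s 1 (fun t => f (z + t *: delta_mx 0 i))
    (partial i f (z + s *: delta_mx 0 i)).
Proof.
move=> df.
have E : (fun h : R => h^-1 *: (f (z + (h *: 1 + s) *: delta_mx 0 i) -
    f (z + s *: delta_mx 0 i))) = (fun h : R => h^-1 *: (f (h *: delta_mx 0 i +
    (z + s *: delta_mx 0 i)) - f (z + s *: delta_mx 0 i))).
  apply/funext => h; congr (_ *: (f _ - _)).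
  by rewrite scaler1 scalerDl addrCA.
by split; rewrite /derivable /partial /derive /= E.
Qed.

Lemma line_increment_le f z (i : 'I_d) (a b m C : R) :
  (forall x, derivable f x (delta_mx 0 i)) ->
  (forall s, Num.min a b <= s <= Num.max a b ->
     `|partial i f (z + s *: delta_mx 0 i) - m| <= C) ->
  `|f (z + b *: delta_mx 0 i) - f (z + a *: delta_mx 0 i) - m * (b - a)|
    <= C * `|b - a|.
Proof.
move=> df; wlog ab : a b / a <= b => [wl bd | bd].
  have [ab|/ltW ba] := leP a b; first exact: wl.
  have := wl b a ba; rewrite minC maxC => /(_ bd); rewrite (distrC b a).
  congr (_ <= _); rewrite -[LHS]normrN; congr (`|_|); ring.
have der (s : R) : is_derive s 1 (fun t => f (z + t *: delta_mx 0 i))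
    (partial i f (z + s *: delta_mx 0 i)) by exact: is_derive_line.
have cont : {within `[a, b], continuous (fun t => f (z + t *: delta_mx 0 i))}.
  by apply: derivable_within_continuous => s _; exact: ex_derive.
have [s sab ->] := MVT_segment ab (fun s _ => der s) cont.
rewrite -mulrBl normrM ler_wpM2r//; apply: bd.
by move: sab; rewrite in_itv/= min_l// max_r.
Qed.

(** A path from [x] to [y] that moves one coordinate at a time stays in the
sup-norm ball around [x] through [y], so the mean value theorem applies to each
of its [d] pieces; [a] is an approximate gradient on that ball. *)
Lemma increment_le f (a : 'I_d -> R) x y (C : R) :
  (forall z i, derivable f z (delta_mx 0 i)) ->
  (forall z, `|z - x| <= `|y - x| -> forall i, `|partial i f z - a i| <= C) ->
  `|f y - f x - \sum_i a i * (y - x) 0 i| <= C * (d%:R * `|y - x|).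
Proof.
move=> df bd.
pose p k : 'rV[R]_d := \row_i (if (i < k)%N then y 0 i else x 0 i).
have px k : `|p k - x| <= `|y - x|.
  apply: norm_le_coord => // i; rewrite !mxE; case: ifP => _.
    by have := coord_le_norm (y - x) i; rewrite !mxE.
  by rewrite subrr normr0.
have main k : (k <= d)%N ->
    `|f (p k) - f x - \sum_(i < d | (i < k)%N) a i * (y - x) 0 i|
      <= C * (k%:R * `|y - x|).
  elim: k => [_|k IH kd].
    rewrite big_pred0// mul0r mulr0 subr0 (_ : p 0%N = x) ?subrr ?normr0//.
    by apply/rowP => i; rewrite mxE.
  pose i := Ordinal kd.
  have pS : p k.+1 = p k + (y - x) 0 i *: delta_mx 0 i.
    apply/rowP => j; rewrite !mxE/= ltnS leq_eqVlt -(inj_eq val_inj)/=.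
    have [jk|jk] /= := eqVneq (j : nat) k; last by rewrite mulr0 addr0.
    have -> : j = i by apply/val_inj.
    by rewrite ltnn mulr1 addrCA subrr addr0.
  rewrite (bigD1 i)/= ?ltnSn//.
  rewrite [X in _ - (_ + X)](_ : _ = \sum_(i < d | (i < k)%N) a i * (y - x) 0 i);
    last first.
    apply: eq_bigl => j; rewrite ltnS leq_eqVlt -(inj_eq val_inj)/=.
    by case: ltngtP.
  have step : `|f (p k.+1) - f (p k) - a i * (y - x) 0 i| <= C * `|y - x|.
    have := @line_increment_le f (p k) i 0 ((y - x) 0 i) (a i) C.
    rewrite scale0r addr0 subr0 -pS => /(_ (fun x => df x i)) H.
    apply: (le_trans (H _)) => [s sab|].
      apply: bd; apply: norm_le_coord => // j; rewrite !mxE eqxx/=.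
      have [->|ji] := eqVneq j i; last first.
        by rewrite mulr0 addr0; have := coord_le_norm (p k - x) j;
           rewrite !mxE => /le_trans; apply.
      rewrite ltnn mulr1 addrAC subrr add0r.
      apply: le_trans (coord_le_norm (y - x) i).
      move: sab; have [t0|t0] := leP 0 ((y - x) 0 i) => /andP[s1 s2].
        by rewrite [leRHS]ger0_norm// ger0_norm.
      by rewrite [leRHS]ltr0_norm// ler0_norm// lerN2.
    rewrite ler_wpM2l ?coord_le_norm//.
    by apply: le_trans (normr_ge0 _) (bd x _ i); rewrite subrr normr0.
  have -> : f (p k.+1) - f x - (a i * (y - x) 0 i +
      \sum_(i < d | (i < k)%N) a i * (y - x) 0 i) =
      (f (p k.+1) - f (p k) - a i * (y - x) 0 i) +
      (f (p k) - f x - \sum_(i < d | (i < k)%N) a i * (y - x) 0 i) by ring.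
  apply: le_trans (ler_normD _ _) _.
  rewrite -natr1 mulrDl mul1r mulrDr addrC lerD//; exact: IH (ltnW kd).
have := main d (leqnn d).
rewrite (_ : p d = y); last by apply/rowP => i; rewrite mxE ltn_ord.
by under eq_bigl do rewrite ltn_ord.
Qed.

(** The regularity kept from test functions: it gives a Taylor estimate with an
explicit quadratic error, it makes the gradient a Lipschitz function, and it is
stable under subtracting constants, which compact support is not. *)
Definition C11 f (L : R) : Prop :=
  [/\ 0 <= L, forall z i, derivable f z (delta_mx 0 i) &
   forall x y i, `|partial i f y - partial i f x| <= L * `|y - x|].

Lemma C11_taylor f L x y : C11 f L ->
  `|f y - f x - \sum_i partial i f x * (y - x) 0 i| <= d%:R * L * `|y - x| ^+ 2.
Proof.
move=> [L0 df Lf]; apply: le_trans (@increment_le _ _ _ _ (L * `|y - x|) df _) _.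
  by move=> z zx i; apply: le_trans (Lf _ _ _) _; rewrite ler_wpM2l.
by rewrite le_eqVlt; apply/orP; left; apply/eqP; ring.
Qed.

Lemma lipschitz_of_partial_le f (C : R) x y :
  (forall z i, derivable f z (delta_mx 0 i)) ->
  (forall z i, `|partial i f z| <= C) -> `|f y - f x| <= C * d%:R * `|y - x|.
Proof.
move=> df bd; have := @increment_le f (fun=> 0) x y C df.
rewrite -mulrA big1 ?subr0; last by move=> i _; rewrite mul0r.
by apply => z _ i; rewrite subr0.
Qed.

Lemma is_derive_lin (a b : R) f g i x : derivable f x (delta_mx 0 i) ->
  derivable g x (delta_mx 0 i) ->
  is_derive x (delta_mx 0 i) (fun z => a * f z + b * g z)
    (a * partial i f x + b * partial i g x).
Proof.
move=> df dg; rewrite (_ : (fun z => _) = (a \*: f) + (b \*: g));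
  last by apply/funext.
by apply: is_deriveD; apply: is_deriveZ; exact: derivableP.
Qed.

Lemma partial_lin (a b : R) f g i x : derivable f x (delta_mx 0 i) ->
  derivable g x (delta_mx 0 i) ->
  partial i (fun z => a * f z + b * g z) x =
    a * partial i f x + b * partial i g x.
Proof. by move=> df dg; apply: derive_val; exact: is_derive_lin. Qed.

Lemma C11_lin (a b : R) f g L M : C11 f L -> C11 g M ->
  C11 (fun z => a * f z + b * g z) (`|a| * L + `|b| * M).
Proof.
move=> [L0 df Lf] [M0 dg Mg]; split; first by rewrite addr_ge0// mulr_ge0.
  by move=> z i; apply: ex_derive; exact: is_derive_lin.
move=> x y i; rewrite !partial_lin//.
rewrite (_ : _ - _ = a * (partial i f y - partial i f x) +
  b * (partial i g y - partial i g x)); last by ring.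
apply: le_trans (ler_normD _ _) _; rewrite mulrDl.
by apply: lerD; rewrite normrM -mulrA ler_wpM2l.
Qed.

Lemma partial_cst (c : R) i x : partial i (fun=> c) x = 0.
Proof. exact: derive_cst. Qed.

Lemma C11_cst (c : R) : C11 (fun=> c) 0.
Proof.
split=> //.
by move=> x y i; rewrite !partial_cst subrr normr0 mul0r.
Qed.

(** The bound propagates along the segment from [x] to [y]: the supremum of the
parameters that it reaches belongs to that set and cannot be less than [1]. The
radius in the hypothesis may depend on the point, which is what makes the lemma
usable with error terms that are only small near each point. *)
Lemma lipschitz_of_locally f (C : R) :
  (forall x, exists2 r : R, 0 < r &
     forall y, `|y - x| < r -> `|f y - f x| <= C * `|y - x|) ->
  forall x y, `|f y - f x| <= C * `|y - x|.
Proof.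
move=> loc x y.
pose g (t : R) := f (x + t *: (y - x)).
pose S := [set t : R | 0 <= t <= 1 /\ `|g t - g 0| <= C * t * `|y - x|].
have S0 : S 0 by rewrite /S/= lexx ler01 subrr normr0 mulr0 mul0r.
have hS : has_sup S by split; [exists 0 | exists 1 => t [/andP[]]].
have s0 : 0 <= sup S by apply: ub_le_sup S0; case: hS.
have s1 : sup S <= 1 by apply: ge_sup => [|t [/andP[]]//]; exists 0.
have [r r0 Hr] := loc (x + sup S *: (y - x)).
have gsub t s : (x + t *: (y - x)) - (x + s *: (y - x)) = (t - s) *: (y - x).
  by rewrite opprD addrACA subrr add0r scalerBl.
pose e := r / (`|y - x| + 1).
have e0 : 0 < e by rewrite divr_gt0// ltr_wpDl.
have near t : `|t - sup S| < e -> `|g t - g (sup S)| <= C * (`|t - sup S| * `|y - x|).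
  move=> te; have := Hr (x + t *: (y - x)); rewrite gsub normrZ; apply.
  apply: (@le_lt_trans _ _ (`|t - sup S| * (`|y - x| + 1))).
    by rewrite ler_wpM2l// lerDl.
  by rewrite -ltr_pdivlMr// ltr_wpDl.
have Ss : S (sup S).
  split; first by rewrite s0 s1.
  have [t [/andP[t0 t1] St] tlt] := sup_adherent e0 hS.
  have ts : t <= sup S.
    by apply: ub_le_sup; [case: hS | split => //; rewrite t0 t1].
  have te : `|t - sup S| < e by rewrite ltr_norml; lra.
  have := near t te; rewrite distrC (distrC t).
  rewrite (_ : `|sup S - t| = sup S - t); last by rewrite ger0_norm ?subr_ge0.
  move=> H.
  rewrite (_ : g (sup S) - g 0 = (g (sup S) - g t) + (g t - g 0)); last by ring.
  apply: le_trans (ler_normD _ _) _; apply: le_trans (lerD H St) _.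
  by rewrite le_eqVlt; apply/orP; left; apply/eqP; ring.
have : sup S = 1.
  apply/eqP; rewrite eq_le s1/= leNgt; apply/negP => slt.
  pose t := Num.min 1 (sup S + e / 2).
  have st : sup S < t by rewrite lt_min slt ltrDl divr_gt0.
  have te : t <= sup S + e / 2 by rewrite ge_min lexx orbT.
  have t1 : t <= 1 by rewrite ge_min lexx.
  suff St : S t by have := ub_le_sup (proj2 hS) St; rewrite leNgt st.
  split; first by rewrite t1 andbT (le_trans s0)// ltW.
  have := near t; rewrite (_ : `|t - sup S| = t - sup S); last first.
    by rewrite gtr0_norm ?subr_gt0.
  move=> H.
  rewrite (_ : g t - g 0 = (g t - g (sup S)) + (g (sup S) - g 0)); last by ring.
  apply: le_trans (ler_normD _ _) _; apply: le_trans (lerD (H _) (proj2 Ss)) _.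
    by lra.
  by rewrite le_eqVlt; apply/orP; left; apply/eqP; ring.
move=> s1E; have := proj2 Ss; rewrite s1E mulr1 /g scale1r scale0r addr0.
by rewrite addrCA subrr addr0.
Qed.

End Calculus.

(** * A Lipschitz function that oscillates at infinitely many scales *)

Section Oscillation.
Context {R : realType} {d : nat}.
Implicit Types (x y v : 'rV[R]_d).
Context (f : nat -> 'rV[R]_d -> R) (L s : nat -> R) (g rho : R).

Local Notation half := (2^-1 : R).

Definition pair_diff k x : R := f k.*2 x - f k.*2.+1 x.

(** The l1 norm of the gradient, because it is dual to the sup norm on
['rV[R]_d]. *)
Definition grad1 (h : 'rV[R]_d -> R) x : R := \sum_i `|partial i h x|.

Definition cutoff x : R := Num.max 0 (Num.min 1 (rho + 1 - `|x|)).

(** Each layer is damped where the earlier ones already have a large gradient;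
at points where all of them have a small gradient the weight stays close to
one. *)
Definition weight k x : R :=
  cutoff x * \prod_(i < k) (1 - grad1 (pair_diff i) x).

Definition layer k x : R := weight k x * pair_diff k x.

Definition layers n x : R := \sum_(k < n) layer k x.

Definition osc x : R := limn (fun n => layers n x).

(* [s j] is the scale below which the functions [f i] with [i < j] look affine
(hypothesis [L_s]), while [f j] and its successors are negligible at that scale
(hypothesis [f_small]); at the scale [s j.+1] the function [f j] has become
visible. *)
Hypothesis g_gt0 : 0 < g.
Hypothesis g_le : g <= 4^-1.
Hypothesis s_gt0 : forall j, 0 < s j.
Hypothesis s_dec : forall j, s j.+1 <= s j.
Hypothesis s_half : forall j, s j <= half ^+ j.
Hypothesis f_C11 : forall j, C11 (f j) (L j).
Hypothesis L_s : forall j, d%:R * L j * s j.+1 <= g * half ^+ j.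
Hypothesis f_small :
  forall j x, `|x| <= rho + 2 -> `|f j x| <= g * half ^+ j * s j.
Hypothesis grad1_le1 : forall k x, grad1 (pair_diff k) x <= 1.

Let half_ge0 k : 0 <= half ^+ k. Proof. by rewrite exprn_ge0// invr_ge0. Qed.

Let half_le1 k : half ^+ k <= 1.
Proof. by rewrite exprn_ile1 ?invr_ge0// invf_le1// ler1n. Qed.

Let half_le j k : (k <= j)%N -> half ^+ j <= half ^+ k.
Proof.
by move=> kj; rewrite ler_wiXn2l ?invr_ge0// invf_le1// ler1n.
Qed.

Let s_le i j : (i <= j)%N -> s j <= s i.
Proof. by apply: (homo_leq (r := fun a b => b <= a)) => // a b c /[swap]; apply: le_trans. Qed.

Let M k := d%:R * (L k.*2 + L k.*2.+1).

Let L_ge0 j : 0 <= L j. Proof. by case: (f_C11 j). Qed.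

Let M_ge0 k : 0 <= M k. Proof. by rewrite mulr_ge0// addr_ge0. Qed.

Lemma pair_diff_C11 k : C11 (pair_diff k) (L k.*2 + L k.*2.+1).
Proof.
have := C11_lin 1 (-1) (f_C11 k.*2) (f_C11 k.*2.+1).
rewrite normrN normr1 !mul1r; congr C11; apply/funext => x.
by rewrite /pair_diff mulN1r mul1r.
Qed.

Lemma grad1_ge0 h x : 0 <= grad1 h x.
Proof. by apply: sumr_ge0. Qed.

Lemma grad1_lip k x y :
  `|grad1 (pair_diff k) y - grad1 (pair_diff k) x| <= M k * `|y - x|.
Proof.
have [_ _ H] := pair_diff_C11 k.
rewrite /grad1 -sumrB; apply: le_trans (ler_norm_sum _ _ _) _.
apply: (@le_trans _ _ (\sum_(i < d) (L k.*2 + L k.*2.+1) * `|y - x|)).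
  by apply: ler_sum => i _; apply: le_trans (ler_dist_dist _ _) _; exact: H.
by rewrite sumr_const card_ord -[leLHS]mulr_natl /M mulrA.
Qed.

Lemma pair_diff_increment k x y :
  `|pair_diff k y - pair_diff k x| <=
    grad1 (pair_diff k) x * `|y - x| + M k * `|y - x| ^+ 2.
Proof.
have := C11_taylor x y (pair_diff_C11 k).
set S := \sum_i _ => T.
have HS : `|S| <= grad1 (pair_diff k) x * `|y - x|.
  apply: le_trans (ler_norm_sum _ _ _) _; rewrite mulr_suml.
  by apply: ler_sum => i _; rewrite normrM ler_wpM2l// coord_le_norm.
rewrite (_ : _ - _ = S + (pair_diff k y - pair_diff k x - S)); last by ring.
by apply: le_trans (ler_normD _ _) _; apply: lerD.
Qed.

Lemma cutoff_ge0 x : 0 <= cutoff x.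
Proof. by rewrite le_max lexx. Qed.

Lemma cutoff_le1 x : cutoff x <= 1.
Proof. by rewrite ge_max ler01 ge_min lexx. Qed.

Lemma cutoff1 x : `|x| <= rho -> cutoff x = 1.
Proof.
by move=> xr; rewrite /cutoff (@min_l _ _ 1) ?max_r//; lra.
Qed.

Lemma cutoff0 x : rho + 1 <= `|x| -> cutoff x = 0.
Proof.
by move=> xr; rewrite /cutoff max_l// ge_min; apply/orP; right; lra.
Qed.

Lemma cutoff_lip x y : `|cutoff y - cutoff x| <= `|y - x|.
Proof.
have := ler_dist_dist x y; rewrite (distrC x y) /cutoff.
set a := `|x|; set b := `|y|; set c := `|y - x|; rewrite !ler_norml.
move=> /andP[h1 h2].
have [p1|p1] := leP 1 (rho + 1 - b); have [p2|p2] := leP 1 (rho + 1 - a);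
have [p3|p3] := leP 0 (rho + 1 - b); have [p4|p4] := leP 0 (rho + 1 - a);
rewrite ?(@max_r _ _ 0 1)//; lra.
Qed.

Let one_sub_ge0 k x : 0 <= 1 - grad1 (pair_diff k) x.
Proof. by rewrite subr_ge0. Qed.

Let one_sub_le1 k x : 1 - grad1 (pair_diff k) x <= 1.
Proof. by rewrite gerBl grad1_ge0. Qed.

Lemma weightS k x : weight k.+1 x = weight k x * (1 - grad1 (pair_diff k) x).
Proof. by rewrite /weight big_ord_recr/= mulrA. Qed.

Lemma weight0 x : weight 0 x = cutoff x.
Proof. by rewrite /weight big_ord0 mulr1. Qed.

Lemma weight_ge0 k x : 0 <= weight k x.
Proof. by rewrite mulr_ge0 ?cutoff_ge0// prodr_ge0. Qed.

Lemma weight_le1 k x : weight k x <= 1.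
Proof.
elim: k => [|k IH]; first by rewrite weight0 cutoff_le1.
by rewrite weightS mulr_ile1// weight_ge0.
Qed.

Lemma weight_out k x : rho + 1 <= `|x| -> weight k x = 0.
Proof. by move=> xr; rewrite /weight cutoff0// mul0r. Qed.

#[local] Opaque weight.

Lemma weight_lip k x y :
  `|weight k y - weight k x| <= (1 + \sum_(i < k) M i) * `|y - x|.
Proof.
elim: k => [|k IH].
  by rewrite !weight0 big_ord0 addr0 mul1r; exact: cutoff_lip.
rewrite !weightS big_ord_recr/= addrA mulrDl.
set a := grad1 _ y; set b := grad1 _ x.
rewrite (_ : _ - _ = (weight k y - weight k x) * (1 - a) - weight k x * (a - b));
  last by ring.
apply: le_trans (ler_normB _ _) _; rewrite 2!normrM; apply: lerD.
  rewrite -[leRHS]mulr1 ler_pM// (ger0_norm (one_sub_ge0 _ _)).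
  exact: one_sub_le1.
rewrite -[leRHS]mul1r; apply: ler_pM => //; last exact: grad1_lip.
by rewrite (ger0_norm (weight_ge0 _ _)) weight_le1.
Qed.

(** The function that the weight of rank [k] multiplies is much smaller than
[s k.*2], so the variation of this weight will be harmless. *)
Lemma weight_lip_scale k : (1 + \sum_(i < k) M i) * s k.*2 <= 3.
Proof.
have sM : \sum_(i < k) M i * s k.*2 <= \sum_(i < k) (2 * g) * half ^+ i.
  apply: ler_sum => i _; rewrite /M mulrDr mulrDl.
  have h j : (j < k.*2)%N -> (i <= j)%N -> d%:R * L j * s k.*2 <= g * half ^+ i.
    move=> jk ij; apply: (@le_trans _ _ (d%:R * L j * s j.+1)).
      by rewrite ler_wpM2l ?s_le// mulr_ge0.
    by apply: le_trans (L_s _) _; rewrite ler_pM2l// half_le.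
  have ik : (i.*2.+1 < k.*2)%N by rewrite -doubleS leq_double.
  have ii : (i <= i.*2)%N by rewrite -addnn leq_addr.
  have := h i.*2 (ltnW ik) ii; have := h i.*2.+1 ik (leqW ii); lra.
rewrite mulrDl mul1r mulr_suml.
have s1 : s k.*2 <= 1 by rewrite (le_trans (s_half _)).
move: sM; rewrite -mulr_sumr => sM.
have : 2 * g * \sum_(i < k) half ^+ i <= 2 * g * 2.
  by rewrite ler_wpM2l ?sum_half_powers// mulr_ge0// ltW.
by move: g_le sM; lra.
Qed.

Lemma pair_diff_small k x : `|x| <= rho + 2 ->
  `|pair_diff k x| <= 2 * g * half ^+ k * s k.*2.
Proof.
move=> xr; apply: le_trans (ler_normB _ _) _.
have h j : (k.*2 <= j)%N -> `|f j x| <= g * half ^+ k * s k.*2.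
  move=> kj; apply: le_trans (f_small _ xr) _.
  rewrite ler_pM// ?mulr_ge0// ?s_le//; try exact: ltW.
  rewrite ler_pM2l// half_le// (leq_trans _ kj)// -addnn leq_addr//.
by have := h _ (leqnn _); have := h _ (leqnSn _); lra.
Qed.

Lemma layer_small k x : `|layer k x| <= 2 * g * half ^+ k * s k.*2.
Proof.
have b0 : 0 <= 2 * g * half ^+ k * s k.*2.
  by rewrite !mulr_ge0//; exact: ltW.
rewrite /layer; have [xr|xr] := leP `|x| (rho + 2); last first.
  by rewrite weight_out ?mul0r ?normr0//; lra.
rewrite normrM -[leRHS]mul1r ler_pM// ?pair_diff_small//.
by rewrite (ger0_norm (weight_ge0 _ _)) weight_le1.
Qed.

Lemma layer_weight_variation k x y : `|y - x| <= 1 ->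
  `|pair_diff k y * (weight k y - weight k x)| <= 6 * g * half ^+ k * `|y - x|.
Proof.
move=> yx1; have g0 := ltW g_gt0; have [yr|yr] := leP `|y| (rho + 2); last first.
  have xr : rho + 1 <= `|x|.
    by have := ler_normD x (y - x); rewrite addrCA subrr addr0; lra.
  rewrite !weight_out//; last by lra.
  by rewrite subr0 mulr0 normr0 !mulr_ge0.
rewrite normrM; apply: (@le_trans _ _ ((2 * g * half ^+ k * s k.*2) *
    ((1 + \sum_(i < k) M i) * `|y - x|))).
  by rewrite ler_pM ?pair_diff_small ?weight_lip.
rewrite [leLHS](_ : _ = ((1 + \sum_(i < k) M i) * s k.*2) *
  (2 * g * half ^+ k * `|y - x|)); last by ring.
rewrite [leRHS](_ : _ = 3 * (2 * g * half ^+ k * `|y - x|)); last by ring.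
by rewrite ler_wpM2r ?weight_lip_scale// !mulr_ge0.
Qed.

Lemma layer_increment k x y : `|y - x| <= 1 ->
  `|layer k y - layer k x| <= weight k x * grad1 (pair_diff k) x * `|y - x| +
     M k * `|y - x| ^+ 2 + 6 * g * half ^+ k * `|y - x|.
Proof.
move=> yx1; rewrite /layer (_ : _ - _ =
  weight k x * (pair_diff k y - pair_diff k x) +
  pair_diff k y * (weight k y - weight k x)); last by ring.
apply: le_trans (ler_normD _ _) _; rewrite lerD ?layer_weight_variation//.
rewrite normrM ger0_norm ?weight_ge0//.
apply: (@le_trans _ _ (weight k x *
    (grad1 (pair_diff k) x * `|y - x| + M k * `|y - x| ^+ 2))).
  by rewrite ler_wpM2l ?weight_ge0// pair_diff_increment.
rewrite mulrDr mulrA lerD2l -[leRHS]mul1r ler_wpM2r ?weight_le1//.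
by rewrite mulr_ge0// exprn_ge0.
Qed.

(** The weights are made for this inequality, which bounds the sum of the
gradients of all the layers independently of their number:
[a_0 + a_1 (1 - a_0) + a_2 (1 - a_0) (1 - a_1) + ...] telescopes. *)
Lemma weight_grad1_sum n x :
  \sum_(k < n) weight k x * grad1 (pair_diff k) x <= 1.
Proof.
suff -> : \sum_(k < n) weight k x * grad1 (pair_diff k) x =
    cutoff x - weight n x.
  by have := weight_ge0 n x; have := cutoff_le1 x; lra.
elim: n => [|n IH]; first by rewrite big_ord0 weight0 subrr.
by rewrite big_ord_recr/= IH weightS; ring.
Qed.

(** The radius on which the quadratic errors of [n] layers are absorbed shrinks
with [n], but the Lipschitz constant does not depend on it. *)
Lemma layers_lip n x y : `|layers n y - layers n x| <= 8 * `|y - x|.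
Proof.
apply: lipschitz_of_locally => {}x.
pose S := \sum_(k < n) M k.
have S0 : 0 <= S by apply: sumr_ge0.
have S1 : 0 < S + 1 by lra.
exists (S + 1)^-1 => [|{}y yx]; first by rewrite invr_gt0.
have yxS : `|y - x| * (S + 1) <= 1 by rewrite -ler_pdivlMr// mul1r ltW.
have yx0 := normr_ge0 (y - x).
have yx1 : `|y - x| <= 1.
  by apply: le_trans yxS; rewrite ler_peMr//; lra.
rewrite /layers -sumrB; apply: le_trans (ler_norm_sum _ _ _) _.
apply: le_trans; first by apply: ler_sum => k _; exact: (layer_increment k yx1).
rewrite !big_split/= -!mulr_suml -[in X in _ + X]mulr_sumr -/S expr2.
have A : \sum_(k < n) weight k x * grad1 (pair_diff k) x * `|y - x| <= `|y - x|.
  by rewrite -mulr_suml ler_piMl// weight_grad1_sum.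
have B : S * (`|y - x| * `|y - x|) <= `|y - x|.
  by rewrite mulrA ler_piMl// mulrC (le_trans _ yxS)// ler_wpM2l//; lra.
have C : 6 * g * (\sum_(k < n) half ^+ k) * `|y - x| <= 3 * `|y - x|.
  rewrite ler_wpM2r//; apply: (@le_trans _ _ (6 * g * 2)); last first.
    by move: g_le; lra.
  by rewrite ler_wpM2l ?sum_half_powers//; move: g_gt0; lra.
by move: A B C; rewrite -mulr_suml; lra.
Qed.

Lemma layers_cvg x : cvgn (fun n => layers n x).
Proof.
have -> : (fun n => layers n x) = series (fun k => layer k x).
  by apply/funext => n; rewrite /series/= /layers big_mkord.
apply: normed_cvg.
apply: (@series_le_cvg _ _ (geometric (2 * g) half)) => [k|k|k|].
- exact: normr_ge0.
- by rewrite /geometric/= mulr_ge0// mulr_ge0// ltW.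
- apply: le_trans (layer_small _ _) _; rewrite /geometric/= ler_piMr//.
    by rewrite !mulr_ge0//; exact: ltW.
  by rewrite (le_trans (s_half _)).
- apply: is_cvg_geometric_series; rewrite ger0_norm ?invr_ge0//.
  by rewrite invf_lt1// ltr1n.
Qed.

Let osc_cvg x y :
  (fun n => layers n y - layers n x) @ \oo --> osc y - osc x.
Proof. by apply: cvgB; exact: layers_cvg. Qed.

Lemma osc_lip x y : `|osc y - osc x| <= 8 * `|y - x|.
Proof.
have /cvg_norm H := @osc_cvg x y.
rewrite -(cvg_lim (@Rhausdorff R) H); apply: limr_le.
  by apply/cvg_ex; eexists; exact: H.
by apply: nearW => n; exact: layers_lip.
Qed.

Lemma osc_lipschitz : lipschitz osc.
Proof.
exists 8; split => // K K8 [x y] _ /=.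
by apply: le_trans (osc_lip _ _) _; rewrite ler_wpM2r// ltW.
Qed.

Section AtPoint.
Context (x v : 'rV[R]_d).
Hypothesis x_in : `|x| <= rho.
Hypothesis v_le1 : `|v| <= 1.
Hypothesis grad1_small : forall k, grad1 (pair_diff k) x <= g * half ^+ k.
Hypothesis slope : forall k, 200 * g <= \sum_i partial i (f k.*2) x * v 0 i.

Let step j : `|x + s j *: v - x| <= s j.
Proof.
rewrite addrC addKr normrZ ger0_norm; last exact: ltW.
by rewrite ler_piMr// ltW.
Qed.

Let s_le1 j : s j <= 1. Proof. by rewrite (le_trans (s_half _)). Qed.

Lemma weight_ge_half k : half <= weight k x.
Proof.
have : 1 - \sum_(i < k) g * half ^+ i <= weight k x.
  elim: k => [|k IH]; first by rewrite big_ord0 weight0 cutoff1// subr0.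
  rewrite weightS big_ord_recr/= mulrBr mulr1 opprD addrA lerB//.
  apply: le_trans (grad1_small k); rewrite ler_piMl ?weight_le1//.
  exact: grad1_ge0.
rewrite -mulr_sumr; have : g * \sum_(i < k) half ^+ i <= g * 2.
  by rewrite ler_pM2l// sum_half_powers.
by move: g_le => ? ? ?; lra.
Qed.

(** At the scale [s j] the layer [i] is invisible unless [f i.*2] is already
resolved and [f i.*2.+1] is not yet, that is [j = i.*2.+1]. The earlier layers
are affine at that scale with a small slope at [x], and the later ones are small
in absolute value. *)
Lemma layer_quotient_small i j : i.*2.+1 != j ->
  `|layer i (x + s j *: v) - layer i x| <= 9 * g * half ^+ i * s j.
Proof.
move=> ij; have hi := half_ge0 i; have sj := ltW (s_gt0 j).
have gh : 0 <= g * half ^+ i by rewrite mulr_ge0//; exact: ltW.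
have ghs : 0 <= g * half ^+ i * s j by rewrite mulr_ge0.
have [ji|ji] := leqP j i.*2.
  apply: le_trans (ler_normB _ _) _.
  apply: le_trans (lerD (layer_small _ _) (layer_small _ _)) _.
  have : g * half ^+ i * s i.*2 <= g * half ^+ i * s j by rewrite ler_wpM2l// s_le.
  by lra.
have {ij ji} ij : (i.*2.+2 <= j)%N by rewrite ltn_neqAle ij.
have st := step j.
apply: le_trans (layer_increment _ (le_trans st (s_le1 j))) _.
have A : weight i x * grad1 (pair_diff i) x * `|x + s j *: v - x| <=
    g * half ^+ i * s j.
  have wg : weight i x * grad1 (pair_diff i) x <= grad1 (pair_diff i) x.
    by rewrite ler_piMl ?weight_le1 ?grad1_ge0.
  apply: ler_pM => //; first by rewrite mulr_ge0 ?weight_ge0 ?grad1_ge0.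
  exact: le_trans wg (grad1_small i).
have B : M i * `|x + s j *: v - x| ^+ 2 <= 2 * (g * half ^+ i) * s j.
  apply: (@le_trans _ _ (M i * (s j * s j))).
    by rewrite ler_wpM2l// -expr2 lerXn2r ?nnegrE.
  rewrite mulrA ler_wpM2r// /M mulrDr mulrDl.
  have h k : (k.+1 <= j)%N -> (i <= k)%N -> d%:R * L k * s j <= g * half ^+ i.
    move=> kj ik; apply: (@le_trans _ _ (d%:R * L k * s k.+1)).
      by rewrite ler_wpM2l ?s_le// mulr_ge0.
    by apply: le_trans (L_s _) _; rewrite ler_pM2l// half_le.
  have ii : (i <= i.*2)%N by rewrite -addnn leq_addr.
  by have := h i.*2 (ltnW ij) ii; have := h i.*2.+1 ij (leqW ii); lra.
have C : 6 * g * half ^+ i * `|x + s j *: v - x| <= 6 * (g * half ^+ i) * s j.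
  by rewrite -(mulrA 6) ler_wpM2l// mulr_ge0.
lra.
Qed.

(** At the scale [s k.*2.+1] the function [f k.*2.+1] is negligible, so only the
slope of [f k.*2] remains of the layer [k]. The second summand on the left is
what the other layers may take back. *)
Lemma layer_quotient_large k :
  74 * g * s k.*2.+1 + 18 * g * s k.*2.+1 <=
    layer k (x + s k.*2.+1 *: v) - layer k x.
Proof.
set t := s _; have t0 : 0 < t by exact: s_gt0.
have st : `|x + t *: v - x| <= t by exact: step.
have t1 : t <= 1 by exact: s_le1.
have gt0 : 0 <= g * t by rewrite mulr_ge0// ltW.
have hk := half_le1 k; have hk0 := half_ge0 k.
have B := layer_weight_variation k (le_trans st t1).
have {}B : `|pair_diff k (x + t *: v) * (weight k (x + t *: v) - weight k x)|
    <= 6 * g * t.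
  apply: (le_trans B); rewrite ler_pM ?mulr_ge0 ?(ltW g_gt0)//.
  by rewrite ler_piMr// mulr_ge0 ?(ltW g_gt0).
have E (z : 'rV[R]_d) : `|z| <= rho + 2 -> `|f k.*2.+1 z| <= g * t.
  move=> zr; apply: (le_trans (f_small _ zr)).
  by rewrite -mulrA -/t ler_wpM2l ?(ltW g_gt0)// ler_piMl// ltW.
have E1 : `|f k.*2.+1 x| <= g * t by apply: E; move: x_in; lra.
have E2 : `|f k.*2.+1 (x + t *: v)| <= g * t.
  apply: E; have := ler_normD x (x + t *: v - x); rewrite addrCA subrr addr0.
  by move: x_in; lra.
have T := C11_taylor x (x + t *: v) (f_C11 k.*2).
have {}T : f k.*2 (x + t *: v) - f k.*2 x >= 200 * g * t - g * t.
  have Tb : d%:R * L k.*2 * `|x + t *: v - x| ^+ 2 <= g * t.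
    apply: (@le_trans _ _ (d%:R * L k.*2 * (t * t))).
      by rewrite ler_wpM2l ?mulr_ge0// -expr2 lerXn2r ?nnegrE// ltW.
    rewrite mulrA ler_pM2r//; apply: le_trans (L_s _) _.
    by rewrite ler_piMr// ltW.
  have S : 200 * g * t <= \sum_i partial i (f k.*2) x * (x + t *: v - x) 0 i.
    rewrite (_ : \sum_i _ = (\sum_i partial i (f k.*2) x * v 0 i) * t).
      by rewrite ler_pM2r.
    rewrite mulr_suml; apply: eq_bigr => i _.
    by rewrite addrC addKr mxE; ring.
  by move: T; rewrite ler_norml => /andP[T _]; lra.
have W := weight_ge_half k; have W1 := weight_le1 k x.
rewrite /layer (_ : _ - _ =
  weight k x * (pair_diff k (x + t *: v) - pair_diff k x) +
  pair_diff k (x + t *: v) * (weight k (x + t *: v) - weight k x)); last by ring.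
have P : 197 * (g * t) <= pair_diff k (x + t *: v) - pair_diff k x.
  by rewrite /pair_diff; move: E1 E2; rewrite !ler_norml => /andP[? ?] /andP[? ?]; lra.
have P' : half * (197 * (g * t)) <=
    weight k x * (pair_diff k (x + t *: v) - pair_diff k x).
  by rewrite ler_pM// ?invr_ge0//; lra.
move: B; rewrite ler_norml => /andP[? ?]; lra.
Qed.

Lemma osc_even_scale k :
  `|osc (x + s k.*2 *: v) - osc x| <= 18 * g * s k.*2.
Proof.
have g0 := ltW g_gt0; have t0 := ltW (s_gt0 k.*2).
set t := s _ in t0 *; have /cvg_norm H := @osc_cvg x (x + t *: v).
rewrite -(cvg_lim (@Rhausdorff R) H); apply: limr_le.
  by apply/cvg_ex; eexists; exact: H.
apply: nearW => n; rewrite /layers -sumrB; apply: le_trans (ler_norm_sum _ _ _) _.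
apply: (@le_trans _ _ (\sum_(i < n) 9 * g * t * half ^+ i)).
  apply: ler_sum => i _; rewrite mulrAC; apply: layer_quotient_small.
  by apply/eqP => /(congr1 odd); rewrite /= !odd_double.
rewrite -mulr_sumr [leRHS](_ : _ = 9 * g * t * 2); last by ring.
by rewrite ler_wpM2l ?sum_half_powers// !mulr_ge0.
Qed.

Lemma osc_odd_scale k :
  74 * g * s k.*2.+1 <= osc (x + s k.*2.+1 *: v) - osc x.
Proof.
have g0 := ltW g_gt0; have t0 := ltW (s_gt0 k.*2.+1).
set t := s _ in t0 *; have H := @osc_cvg x (x + t *: v).
rewrite -(cvg_lim (@Rhausdorff R) H); apply: limr_ge.
  by apply/cvg_ex; eexists; exact: H.
near=> n; rewrite /layers -sumrB.
have kn : (k < n)%N by near: n; exact: nbhs_infty_gt.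
rewrite (bigD1 (Ordinal kn))//=.
have := layer_quotient_large k; rewrite -/t.
set S := \sum_(i < n | _) _ => A.
suff : `|S| <= 18 * g * t by rewrite ler_norml => /andP[? ?]; lra.
apply: le_trans (ler_norm_sum _ _ _) _.
apply: (@le_trans _ _ (\sum_(i < n | i != Ordinal kn) 9 * g * t * half ^+ i)).
  apply: ler_sum => i ik; rewrite mulrAC; apply: layer_quotient_small.
  apply: contra ik => /eqP[]/double_inj ik; exact/eqP/val_inj.
apply: (@le_trans _ _ (\sum_(i < n) 9 * g * t * half ^+ i)).
  by rewrite [leRHS](bigD1 (Ordinal kn))//= lerDr !mulr_ge0.
rewrite -mulr_sumr [leRHS](_ : _ = 9 * g * t * 2); last by ring.
by rewrite ler_wpM2l ?sum_half_powers// !mulr_ge0.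
Unshelve. all: by end_near. Qed.

(** Along the scales [s j] the difference quotients of [osc] in the direction
[v] are at most [18 * g] for even [j] and at least [74 * g] for odd [j]. *)
Lemma osc_not_differentiable (V : {vspace 'rV[R]_d}) :
  v \in V -> ~ differentiable_along osc x V.
Proof.
move=> vV [Lv /(_ g g_gt0)[r r0 Hr]].
have [k kr] : exists k, half ^+ k < r.
  have : geometric 1 half @ \oo --> 0.
    by apply: cvg_geometric; rewrite ger0_norm ?invr_ge0// invf_lt1// ltr1n.
  move=> /cvgrPdist_lt/(_ r r0)[k _ /(_ k (leqnn k))]/=.
  rewrite sub0r normrN mul1r ger0_norm ?half_ge0// => ?; by exists k.
pose w : subvs_of V := vsproj V v.
have wE : vsval w = v by rewrite /w vsprojK.
have D j : (k <= j)%N ->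
    `|osc (x + s j *: v) - osc x - s j * Lv w| <= g * s j.
  move=> kj; have := Hr (s j *: w).
  have vn : `|s j *: v| <= s j.
    rewrite normrZ ger0_norm ?(ltW (s_gt0 j))// ler_piMr// ltW//.
  rewrite !linearZ/= wE => H.
  have {}H := H (le_lt_trans vn (le_lt_trans (le_trans (s_half j) (half_le kj)) kr)).
  by apply: (le_trans H); rewrite ler_pM2l.
have kk : (k <= k.*2)%N by rewrite -addnn leq_addr.
have D0 := D _ kk; have D1 := D _ (leqW kk).
have Lw : Lv w <= 19 * g.
  rewrite -(ler_pM2l (s_gt0 k.*2)).
  by have := osc_even_scale k; move: D0; rewrite !ler_norml => /andP[? ?] /andP[? ?]; lra.
have : s k.*2.+1 * (73 * g) <= s k.*2.+1 * Lv w.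
  by have := osc_odd_scale k; move: D1; rewrite !ler_norml => /andP[? ?]; lra.
rewrite ler_pM2l//; move: g_gt0; lra.
Qed.

End AtPoint.

End Oscillation.

(** * Measurability and integrability on balls *)

Section Borel.
Context {R : realType} {d : nat}.
Implicit Types (f : 'rV[R]_d -> R) (mu : {measure set (borel_rV R d) -> \bar R}).

Lemma continuous_borel_measurable f : continuous f ->
  measurable_fun setT (f : borel_rV R d -> R).
Proof.
move=> /continuousP cf; apply: (measurability _ (RGenOpens.measurableE R)).
move=> _ [_ [a [b ->] <-]]; rewrite setTI; apply: sub_sigma_algebra.
exact/cf/interval_open.
Qed.

Lemma lipschitz_continuous f (C : R) :
  (forall x y, `|f y - f x| <= C * `|y - x|) -> continuous f.
Proof.
move=> fC x; have C1 : 0 < `|C| + 1 by rewrite ltr_wpDl.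
have FF : Filter (nbhs x) by exact: nbhs_filter.
apply/(@cvgrPdist_lt _ _ _ (nbhs x) FF) => e e0; apply/nbhs_ballP.
exists (e / (`|C| + 1)) => [|y] /=; first by rewrite divr_gt0.
rewrite -ball_normE /= ltr_pdivlMr// => xy.
rewrite distrC; apply: le_lt_trans (fC _ _) _; apply: le_lt_trans xy.
by rewrite mulrC distrC ler_wpM2l// (le_trans (ler_norm C))// lerDl.
Qed.

Lemma C11_measurable_partial f L i : C11 f L ->
  measurable_fun setT (partial i f : borel_rV R d -> R).
Proof.
move=> [_ _ Lf]; apply: continuous_borel_measurable.
by apply: (@lipschitz_continuous _ L) => x y; exact: Lf.
Qed.

Definition cball (rho : R) : set 'rV[R]_d := [set x | `|x| <= rho].

Lemma cball_compact rho : compact (cball rho).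
Proof.
have -> : cball rho = if 0 <= rho then
    [set v : 'rV[R]_d | forall i, v ord0 i \in `[(- rho), rho]] else set0.
  apply/seteqP; split => x /=; rewrite /cball/=.
    case: ifP => [_ xr i /=|/negbT]; last first.
      by rewrite -ltNge => r0 xr; have := normr_ge0 x; lra.
    by rewrite in_itv/= -ler_norml (le_trans (coord_le_norm _ _)).
  case: ifP => // r0 /= xr; apply: norm_le_coord => // i.
  by rewrite ler_norml; have := xr i; rewrite in_itv.
case: ifP => _; last exact: compact0.
apply: (@rV_compact _ _ (fun=> `[(- rho), rho]%classic)) => i.
exact: segment_compact.
Qed.

Lemma cball_measurable rho : measurable (cball rho : set (borel_rV R d)).
Proof.
rewrite -[X in measurable X]setCK; apply: measurableC; apply: sub_sigma_algebra.
apply: closed_openC; apply: compact_closed; last exact: cball_compact.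
exact: norm_hausdorff.
Qed.

Lemma ae_mono2 mu (P Q S : 'rV[R]_d -> Prop) :
  (forall x, P x -> Q x -> S x) ->
  {ae mu, forall x, P x} -> {ae mu, forall x, Q x} -> {ae mu, forall x, S x}.
Proof.
move=> PQS aP aQ; apply: negligibleS (negligibleU aP aQ) => x /= nS.
apply: contrapT => /not_orP[/contrapT Px /contrapT Qx].
exact: nS (PQS x Px Qx).
Qed.

Lemma integrable_bounded mu (B : set (borel_rV R d)) f (C : R) :
  measurable B -> (mu B < +oo)%E ->
  measurable_fun setT (f : borel_rV R d -> R) -> (forall x, `|f x| <= C) ->
  mu.-integrable B (EFin \o (f : borel_rV R d -> R)).
Proof.
move=> mB Bfin mf fC; apply: measurable_bounded_integrable => //.
  exact: measurable_funS mf.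
exists C; split; first exact: num_real.
by move=> M CM x _ /=; rewrite (le_trans (fC x))// ltW.
Qed.

End Borel.

(** * Almost minimizers of a quadratic energy *)

Section Minimizing.
Context {R : realType} {F : Type}.
Context (P : R -> F -> Prop) (J : F -> R) (Q : F -> F -> R) (mid : F -> F -> F).
Context (C : R).
Hypothesis P_nonempty : forall eta, 0 < eta -> exists f, P eta f.
Hypothesis P_mid : forall eta f g, P eta f -> P eta g -> P eta (mid f g).
Hypothesis J_ge0 : forall f, 0 <= J f.
Hypothesis J_le : forall eta f, P eta f -> J f <= C.
Hypothesis parallelogram : forall eta f g, P eta f -> P eta g ->
  4 * J (mid f g) + Q f g = 2 * J f + 2 * J g.

(** The usual proof that minimizing sequences in a convex set are Cauchy, for
the decreasing family of convex sets [P eta] instead of one set: [m] is the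
limit of the infima of [J] over [P eta] as [eta] decreases to [0], and the
midpoint of two almost minimizers has energy at least about [m]. *)
Lemma almost_minimizers_close : exists m : R,
  (forall kappa, 0 < kappa -> forall eta, 0 < eta ->
     exists2 f, P eta f & J f <= m + kappa) /\
  (forall kappa, 0 < kappa -> exists2 eta, 0 < eta & forall f g,
     P eta f -> P eta g -> J f <= m + kappa -> J g <= m + kappa ->
     Q f g <= 8 * kappa).
Proof.
(* The infimum of this set is the supremum over [eta] of the infima of [J] on
[P eta]. *)
pose S := [set a : R | forall eta, 0 < eta -> exists2 f, P eta f & J f <= a].
have SC : S C.
  by move=> eta /P_nonempty[f Pf]; exists f => //; exact: J_le Pf.
have iS : has_inf S.
  split; first by exists C.
  exists 0 => a /(_ 1 ltr01)[f _]; exact: le_trans.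
exists (inf S); split => kappa k0.
  move=> eta e0; have [a Sa] := inf_adherent k0 iS.
  have [f Pf Jf] := Sa _ e0; move=> /ltW am.
  by exists f => //; exact: le_trans am.
have nS : ~ S (inf S - kappa).
  by move=> /(ge_inf iS.2) H; lra.
have [eta e0 He] : exists2 eta, 0 < eta &
    forall f, P eta f -> inf S - kappa < J f.
  apply: contrapT => H; apply: nS => eta e0; apply: contrapT => H'.
  apply: H; exists eta => // f Pf; rewrite ltNge; apply/negP => Jf.
  by apply: H'; exists f.
exists eta => // f g Pf Pg Jf Jg.
have := parallelogram Pf Pg; have := He _ (P_mid Pf Pg); lra.
Qed.

End Minimizing.

(** * Flux and energy of functions with a bounded gradient *)

Section Flux.
Context {R : realType} {d : nat}.
Context (mu : {measure set (borel_rV R d) -> \bar R}) (rho : R).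
Context (sigma : 'rV[R]_d -> 'rV[R]_d).
Implicit Types (f h : 'rV[R]_d -> R) (x : 'rV[R]_d).

Local Notation B := (cball rho : set (borel_rV R d)).
Local Notation half := (2^-1 : R).

(** Chosen so that the difference of two functions with partial derivatives
bounded by it has an l1 gradient norm at most one. *)
Definition slope_bound : R := (2 * (d%:R + 1))^-1.

Definition flux_density f x : R := \sum_i sigma x 0 i * partial i f x.

Definition flux f : R := \int[mu]_(x in B) flux_density f x.

Definition energy f : R := \int[mu]_(x in B) (\sum_i partial i f x ^+ 2).

Definition sqdist f h x : R := \sum_i (partial i f x - partial i h x) ^+ 2.

Definition bounded_slope f : Prop :=
  (exists L, C11 f L) /\ (forall i x, `|partial i f x| <= slope_bound).

(** Functions that would contradict the continuity of the flux if they existed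
for every positive [eta]. *)
Definition admissible (eps eta : R) f : Prop :=
  [/\ bounded_slope f, (forall x, `|x| <= rho + 2 -> `|f x| <= eta) &
      eps <= flux f].

Hypothesis B_fin : (mu B < +oo)%E.
Hypothesis sigma_meas :
  forall i, measurable_fun setT (fun x : borel_rV R d => sigma x 0 i).
Hypothesis sigma_le1 : forall x, `|sigma x| <= 1.

Lemma slope_bound_gt0 : 0 < slope_bound.
Proof. by rewrite invr_gt0 mulr_gt0// ltr_wpDl. Qed.

Lemma slope_bound_dim : d%:R * slope_bound <= half.
Proof.
rewrite /slope_bound; have d0 : 0 <= d%:R :> R by [].
by rewrite ler_pdivrMr; lra.
Qed.

Let mB : measurable B. Proof. exact: cball_measurable. Qed.

Definition bounded_C11 f : Prop :=
  (exists L, C11 f L) /\ exists C : R, forall i x, `|partial i f x| <= C.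

Lemma bounded_slope_C11 f : bounded_slope f -> bounded_C11 f.
Proof. by move=> [fL fA]; split => //; exists slope_bound. Qed.

Lemma flux_density_meas f L : C11 f L ->
  measurable_fun setT (flux_density f : borel_rV R d -> R).
Proof.
move=> fL; apply: measurable_sum => i.
apply: measurable_funM; first exact: sigma_meas.
exact: C11_measurable_partial fL.
Qed.

Lemma flux_density_le_sum f (C : R) x : (forall i, `|partial i f x| <= C) ->
  `|flux_density f x| <= d%:R * C.
Proof.
move=> fC; apply: le_trans (ler_norm_sum _ _ _) _.
apply: (@le_trans _ _ (\sum_(i < d) C)).
  apply: ler_sum => i _; rewrite normrM -[leRHS]mul1r ler_pM//.
  exact: le_trans (coord_le_norm _ _) (sigma_le1 x).
by rewrite sumr_const card_ord -[leLHS]mulr_natl.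
Qed.

Lemma flux_density_le f x : bounded_slope f -> `|flux_density f x| <= 1.
Proof.
move=> [_ fA]; apply: le_trans (flux_density_le_sum (fA^~ x)) _.
by apply: le_trans slope_bound_dim _; lra.
Qed.

Lemma flux_density_integrable f : bounded_C11 f ->
  mu.-integrable B (EFin \o (flux_density f : borel_rV R d -> R)).
Proof.
move=> [[L fL] [C fC]]; apply: (integrable_bounded (C := d%:R * C)) => //.
  exact: flux_density_meas fL.
by move=> x; exact: flux_density_le_sum.
Qed.

Let integrable_scale k f :
  mu.-integrable B (EFin \o (f : borel_rV R d -> R)) ->
  mu.-integrable B (EFin \o (fun x : borel_rV R d => k * f x)).
Proof.
move=> If; rewrite (_ : _ \o _ = (fun x => k%:E * (f x)%:E)%E).
  exact: integrableZl.
by apply/funext => x; rewrite /= EFinM.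
Qed.

Lemma flux_lin (a b : R) f h : bounded_C11 f -> bounded_C11 h ->
  flux (fun x => a * f x + b * h x) = a * flux f + b * flux h.
Proof.
move=> fb hb; have If := flux_density_integrable fb.
have Ih := flux_density_integrable hb.
rewrite /flux -!RintegralZl// -RintegralD//; try exact: integrable_scale.
apply: eq_Rintegral => x _; rewrite /flux_density !mulr_sumr -big_split/=.
case: fb hb => -[L [_ df _]] _ [[M [_ dh _]] _].
by apply: eq_bigr => i _; rewrite partial_lin//; ring.
Qed.

Lemma sqdist_meas f h : bounded_slope f -> bounded_slope h ->
  measurable_fun setT (sqdist f h : borel_rV R d -> R).
Proof.
move=> [[L fL] _] [[M hM] _]; apply: measurable_sum => i.
apply: measurable_funX; apply: measurable_funB.
  exact: C11_measurable_partial fL.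
exact: C11_measurable_partial hM.
Qed.

Lemma sqdist_ge0 f h x : 0 <= sqdist f h x.
Proof. by apply: sumr_ge0 => i _; rewrite sqr_ge0. Qed.

Lemma sqdist_le f h x : bounded_slope f -> bounded_slope h ->
  sqdist f h x <= d%:R * (2 * slope_bound) ^+ 2.
Proof.
move=> [_ fA] [_ hA].
apply: (@le_trans _ _ (\sum_(i < d) (2 * slope_bound) ^+ 2)).
  apply: ler_sum => i _; rewrite -real_normK ?num_real// lerXn2r ?nnegrE//.
    by rewrite mulr_ge0// ltW// slope_bound_gt0.
  apply: le_trans (ler_normB _ _) _; have := fA i x; have := hA i x; lra.
by rewrite sumr_const card_ord -[leLHS]mulr_natl.
Qed.

Let sqdist_int f h : bounded_slope f -> bounded_slope h ->
  mu.-integrable B (EFin \o (sqdist f h : borel_rV R d -> R)).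
Proof.
move=> fb hb; apply: (integrable_bounded
    (C := d%:R * (2 * slope_bound) ^+ 2)) => //.
  exact: sqdist_meas.
by move=> x; rewrite ger0_norm ?sqdist_ge0// sqdist_le.
Qed.

Lemma bounded_slope0 : bounded_slope (fun=> 0).
Proof.
split; first by exists 0; exact: C11_cst.
by move=> i x; rewrite partial_cst normr0 ltW// slope_bound_gt0.
Qed.

Lemma energyE f : energy f = \int[mu]_(x in B) sqdist f (fun=> 0) x.
Proof.
apply: eq_Rintegral => x _; apply: eq_bigr => i _.
by rewrite partial_cst subr0.
Qed.

Definition mid f h x : R := half * f x + half * h x.

Lemma partial_mid f h i x : bounded_slope f -> bounded_slope h ->
  partial i (mid f h) x = half * partial i f x + half * partial i h x.
Proof.
by move=> [[L [_ df _]] _] [[M [_ dh _]] _]; rewrite partial_lin.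
Qed.

Lemma bounded_slope_mid f h : bounded_slope f -> bounded_slope h ->
  bounded_slope (mid f h).
Proof.
move=> fb hb; split.
  case: fb hb => -[L fL] _ [[M hM] _]; eexists.
  exact: C11_lin fL hM.
move=> i x; rewrite partial_mid//; case: fb hb => _ fA [_ hA].
apply: le_trans (ler_normD _ _) _; rewrite !normrM ger0_norm ?invr_ge0//.
by have := fA i x; have := hA i x; lra.
Qed.

Lemma flux_mid f h : bounded_slope f -> bounded_slope h ->
  flux (mid f h) = half * flux f + half * flux h.
Proof.
by move=> fb hb; apply: flux_lin; exact: bounded_slope_C11.
Qed.

Lemma admissible_mid eps eta f h :
  admissible eps eta f -> admissible eps eta h -> admissible eps eta (mid f h).
Proof.
move=> [fb fe ff] [hb he fh]; split; first exact: bounded_slope_mid.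
  move=> x xr; apply: le_trans (ler_normD _ _) _.
  rewrite !normrM ger0_norm ?invr_ge0//.
  have := fe x xr; have := he x xr.
  by move: `|f x| `|h x| => a b {ff fh}; lra.
rewrite flux_mid//; by move: (flux f) (flux h) ff fh => a b; lra.
Qed.

Lemma energy_ge0 f : 0 <= energy f.
Proof.
by apply: Rintegral_ge0 => x _; apply: sumr_ge0 => i _; rewrite sqr_ge0.
Qed.

Lemma energy_le f : bounded_slope f ->
  energy f <= d%:R * (2 * slope_bound) ^+ 2 * fine (mu B).
Proof.
move=> fb; rewrite energyE -Rintegral_cst//; apply: le_Rintegral => //.
- exact: sqdist_int bounded_slope0.
- apply: (integrable_bounded (C := d%:R * (2 * slope_bound) ^+ 2)) => // x.
  by rewrite ger0_norm// mulr_ge0// sqr_ge0.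
- by move=> x _; exact: sqdist_le bounded_slope0.
Qed.

Lemma energy_parallelogram f h : bounded_slope f -> bounded_slope h ->
  4 * energy (mid f h) + \int[mu]_(x in B) sqdist f h x =
  2 * energy f + 2 * energy h.
Proof.
move=> fb hb; have b0 := bounded_slope0; rewrite !energyE.
have mb := bounded_slope_mid fb hb.
have Im := sqdist_int mb b0; have If := sqdist_int fb b0.
have Ih := sqdist_int hb b0; have Ifh := sqdist_int fb hb.
have lhs := etrans (RintegralD mB (integrable_scale 4 Im) Ifh)
  (f_equal (fun t => t + _) (RintegralZl 4 mB Im)).
have rhs := etrans (RintegralD mB (integrable_scale 2 If) (integrable_scale 2 Ih))
  (f_equal2 +%R (RintegralZl 2 mB If) (RintegralZl 2 mB Ih)).
refine (etrans (esym lhs) (etrans _ rhs)).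
apply: eq_Rintegral => x _; rewrite /sqdist !mulr_sumr -!big_split/=.
by apply: eq_bigr => i _; rewrite partial_mid// !partial_cst !subr0; field.
Qed.

End Flux.

(** * Functions of large flux contradict differentiability *)

Section LargeFlux.
Context {R : realType} {d : nat}.
Context (mu : {measure set (borel_rV R d) -> \bar R}) (rho : R).
Context (sigma : 'rV[R]_d -> 'rV[R]_d).
Implicit Types (f h : 'rV[R]_d -> R) (x : 'rV[R]_d).

Local Notation B := (cball rho : set (borel_rV R d)).
Local Notation half := (2^-1 : R).

Hypothesis B_fin : (mu B < +oo)%E.
Hypothesis sigma_meas :
  forall i, measurable_fun setT (fun x : borel_rV R d => sigma x 0 i).
Hypothesis sigma_le1 : forall x, `|sigma x| <= 1.

(** The functions [f j] are almost minimizers of the energy, so that their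
gradients converge fast in mean square on the ball, and each of them is chosen
after the scale [s j], which depends on the previous ones only. *)
Lemma minimizing_sequence (eps g : R) (kappa : nat -> R) :
  (forall eta, 0 < eta -> exists f, admissible mu rho sigma eps eta f) ->
  0 < g -> g <= 1 -> (forall j, 0 < kappa j) ->
  (forall j, kappa j.+1 <= kappa j) ->
  exists (f : nat -> 'rV[R]_d -> R) (L s : nat -> R),
  [/\ forall j, [/\ 0 < s j, s j.+1 <= s j & s j <= half ^+ j],
      forall j, C11 (f j) (L j) /\ d%:R * L j * s j.+1 <= g * half ^+ j,
      forall j x, `|x| <= rho + 2 -> `|f j x| <= g * half ^+ j * s j,
      forall j, bounded_slope (f j) &
      eps <= flux mu rho sigma (f 0%N) /\
      forall j, \int[mu]_(x in B) sqdist (f j) (f j.+1) x <= 8 * kappa j].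
Proof.
move=> adm g0 g1 k0 kdec.
have half_gt0 j : 0 < half ^+ j by rewrite exprn_gt0// invr_gt0.
have half_le1 j : half ^+ j <= 1 by rewrite exprn_ile1 ?invr_ge0// invf_le1// ler1n.
have [m [mex mclose]] := almost_minimizers_close
  (Q := fun f h => \int[mu]_(x in B) sqdist f h x) adm
  (fun eta f h => @admissible_mid _ _ mu rho sigma B_fin sigma_meas sigma_le1 eps eta f h)
  (energy_ge0 mu rho)
  (fun eta f (fa : admissible mu rho sigma eps eta f) =>
     let: And3 fb _ _ := fa in energy_le B_fin fb)
  (fun eta f h (fa : admissible mu rho sigma eps eta f)
     (ha : admissible mu rho sigma eps eta h) =>
     let: And3 fb _ _ := fa in let: And3 hb _ _ := ha in
     energy_parallelogram B_fin fb hb).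
have /choice[eta0 eta0P] : forall j, exists eta : R, 0 < eta /\ forall f h,
    admissible mu rho sigma eps eta f -> admissible mu rho sigma eps eta h ->
    energy mu rho f <= m + kappa j -> energy mu rho h <= m + kappa j ->
    \int[mu]_(x in B) sqdist f h x <= 8 * kappa j.
  by move=> j; have [eta e0 H] := mclose _ (k0 j); exists eta.
have /choice[pick pickP] : forall p : nat * R, exists f, 0 < p.2 ->
    admissible mu rho sigma eps (Num.min (eta0 p.1) (g * half ^+ p.1 * p.2)) f /\
    energy mu rho f <= m + kappa p.1.
  move=> [j s] /=; have [s0|] := boolP (0 < s); last by exists (fun=> 0).
  have e0 : 0 < Num.min (eta0 j) (g * half ^+ j * s).
    by rewrite lt_min (proj1 (eta0P j)) !mulr_gt0.
  by have [f fa fe] := mex (kappa j) (k0 j) _ e0; exists f.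
have /choice[lip lipP] : forall f, exists L, bounded_slope f -> C11 f L.
  move=> f; have [[[L fL] _]|nb] := pselect (bounded_slope f); first by exists L.
  by exists 0 => fb.
pose s := fix s j : R := if j is j'.+1 then
  let f := pick (j', s j') in
  Num.min (Num.min (s j') (half ^+ j))
    (Num.min (eta0 j') (g * half ^+ j' / (d%:R * lip f + 1))) else 1.
pose f j := pick (j, s j).
have sS j : s j.+1 = Num.min (Num.min (s j) (half ^+ j.+1))
    (Num.min (eta0 j) (g * half ^+ j / (d%:R * lip (f j) + 1))) by [].
have fadm j : 0 < s j -> admissible mu rho sigma eps
    (Num.min (eta0 j) (g * half ^+ j * s j)) (f j) /\
    energy mu rho (f j) <= m + kappa j by exact: (pickP (j, s j)).
have den j : 0 < s j -> 0 < d%:R * lip (f j) + 1.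
  move=> sj; have [[fb _ _] _] := fadm j sj; have [L0 _ _] := lipP _ fb.
  by rewrite ltr_wpDl// mulr_ge0.
have s0 j : 0 < s j.
  elim: j => [|j IH]; first exact: ltr01.
  by rewrite sS !lt_min IH half_gt0 (proj1 (eta0P j)) divr_gt0 ?den// mulr_gt0.
have sdec j : s j.+1 <= s j by rewrite sS !ge_min lexx.
have seta j : s j.+1 <= eta0 j by rewrite sS !ge_min lexx !orbT.
have fb j : bounded_slope (f j) by have [[]] := fadm j (s0 j).
have fsmall j x : `|x| <= rho + 2 -> `|f j x| <= g * half ^+ j * s j.
  move=> xr; have [[_ /(_ x xr) + _] _] := fadm j (s0 j).
  by rewrite le_min => /andP[].
exists f, (fun j => lip (f j)), s; split => //.
- move=> j; split => //; case: j => [|j]; first by rewrite expr0.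
  by rewrite sS !ge_min lexx !orbT.
- move=> j; have fL := lipP _ (fb j); split => //; have [L0 _ _] := fL.
  apply: (@le_trans _ _ ((d%:R * lip (f j) + 1) * s j.+1)).
    by rewrite ler_wpM2r ?(ltW (s0 _))// lerDl.
  by rewrite mulrC -ler_pdivlMr ?den// sS !ge_min lexx !orbT.
- split; first by have [[]] := fadm 0%N (s0 0%N).
  move=> j; have [[_ _ fe] fE] := fadm j (s0 j).
  have [[_ _ he] hE] := fadm j.+1 (s0 j.+1).
  have fadm' : admissible mu rho sigma eps (eta0 j) (f j).
    split => // x xr; have [[_ /(_ x xr) + _] _] := fadm j (s0 j).
    by rewrite le_min => /andP[].
  have hadm' : admissible mu rho sigma eps (eta0 j) (f j.+1).
    split => // x xr; apply: le_trans (fsmall _ _ xr) _; apply: le_trans (seta j).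
    by rewrite ler_piMl ?(ltW (s0 _))// mulr_ile1// ltW.
  have hE' : energy mu rho (f j.+1) <= m + kappa j.
    by apply: le_trans hE _; rewrite lerD2l.
  exact: (eta0P j).2 _ _ fadm' hadm' fE hE'.
Qed.

Context (W : 'rV[R]_d -> {vspace 'rV[R]_d}).
Hypothesis sigma_W : {ae mu, forall x, sigma x \in W x}.
Hypothesis W_diff : forall u : 'rV[R]_d -> R, lipschitz u ->
  {ae mu, forall x, differentiable_along u x (W x)}.

Lemma grad1_pair_diff_le (f : nat -> 'rV[R]_d -> R) k x :
  bounded_slope (f k.*2) -> bounded_slope (f k.*2.+1) ->
  grad1 (pair_diff f k) x =
  \sum_i `|partial i (f k.*2) x - partial i (f k.*2.+1) x|.
Proof.
move=> [[L [_ df _]] _] [[M [_ dh _]] _]; apply: eq_bigr => i _; congr (`|_|).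
rewrite (_ : pair_diff f k = fun z => 1 * f k.*2 z + (-1) * f k.*2.+1 z).
  by rewrite partial_lin// mulN1r mul1r.
by apply/funext => z; rewrite mul1r mulN1r.
Qed.

Section Excess.
Context (f : nat -> 'rV[R]_d -> R) (L s : nat -> R) (g : R).
Hypothesis g_gt0 : 0 < g.
Hypothesis g_le : g <= 4^-1.
Hypothesis sP : forall j, [/\ 0 < s j, s j.+1 <= s j & s j <= half ^+ j].
Hypothesis fL : forall j, C11 (f j) (L j) /\ d%:R * L j * s j.+1 <= g * half ^+ j.
Hypothesis fsmall :
  forall j x, `|x| <= rho + 2 -> `|f j x| <= g * half ^+ j * s j.
Hypothesis fb : forall j, bounded_slope (f j).

(** The term of rank [j] of the excess series reaches one as soon as a partial
derivative of [f j] and the same one of [f j.+1] are too far apart for the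
oscillation estimate. *)
Definition excess_weight j : R := ((d%:R + 1) / (g * half ^+ j)) ^+ 2.

Let half_gt0 j : 0 < half ^+ j. Proof. by rewrite exprn_gt0// invr_gt0. Qed.

Let d1 : 0 < d%:R + 1 :> R. Proof. by rewrite ltr_wpDl. Qed.

Lemma grad1_pair_diff_le1 k x : grad1 (pair_diff f k) x <= 1.
Proof.
rewrite grad1_pair_diff_le//.
apply: (@le_trans _ _ (\sum_(i < d) 2 * @slope_bound R d)).
  apply: ler_sum => i _; apply: le_trans (ler_normB _ _) _.
  by have := (fb k.*2).2 i x; have := (fb k.*2.+1).2 i x; lra.
rewrite sumr_const card_ord -[leLHS]mulr_natl mulrCA.
by have := @slope_bound_dim R d; lra.
Qed.

Lemma partial_dist_small j i x : excess_weight j * sqdist (f j) (f j.+1) x <= 1 ->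
  `|partial i (f j) x - partial i (f j.+1) x| <= g * half ^+ j / (d%:R + 1).
Proof.
move=> t1.
have q0 : 0 <= g * half ^+ j / (d%:R + 1).
  by rewrite divr_ge0 ?mulr_ge0 ?(ltW g_gt0) ?(ltW (half_gt0 _)) ?(ltW d1).
rewrite -(@ler_pXn2r _ 2)// ?nnegrE// real_normK ?num_real//.
apply: (@le_trans _ _ (sqdist (f j) (f j.+1) x)).
  by rewrite /sqdist (bigD1 i)//= lerDl sumr_ge0// => k _; rewrite sqr_ge0.
have qc : (g * half ^+ j / (d%:R + 1)) * ((d%:R + 1) / (g * half ^+ j)) = 1.
  by field; rewrite !gt_eqF// mulr_gt0.
rewrite [leLHS](_ : _ = (g * half ^+ j / (d%:R + 1)) ^+ 2 *
    (excess_weight j * sqdist (f j) (f j.+1) x)).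
  by rewrite ler_piMr// exprn_ge0.
by rewrite mulrA -exprMn qc expr1n mul1r.
Qed.

Lemma partial_sum_small j x : excess_weight j * sqdist (f j) (f j.+1) x <= 1 ->
  \sum_i `|partial i (f j) x - partial i (f j.+1) x| <= g * half ^+ j.
Proof.
move=> t1; apply: (@le_trans _ _ (\sum_(i < d) g * half ^+ j / (d%:R + 1))).
  by apply: ler_sum => i _; exact: partial_dist_small.
rewrite sumr_const card_ord -[leLHS]mulr_natl mulrA ler_pdivrMr//.
by rewrite mulrC ler_pM2l ?mulr_gt0// lerDl.
Qed.

Lemma slope_persists x n :
  (forall j, excess_weight j * sqdist (f j) (f j.+1) x <= 1) ->
  flux_density sigma (f 0%N) x - 2 * g <= flux_density sigma (f n) x.
Proof.
move=> t1.
have step k : `|flux_density sigma (f k) x - flux_density sigma (f k.+1) x|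
    <= g * half ^+ k.
  apply: le_trans (partial_sum_small (t1 k)); rewrite /flux_density -sumrB.
  apply: le_trans (ler_norm_sum _ _ _) _; apply: ler_sum => i _.
  rewrite -mulrBr normrM ler_piMl//.
  exact: le_trans (coord_le_norm _ _) (sigma_le1 x).
have : flux_density sigma (f 0%N) x - \sum_(j < n) g * half ^+ j <=
    flux_density sigma (f n) x.
  elim: n => [|n IH]; first by rewrite big_ord0 subr0.
  rewrite big_ord_recr/=; move: (step n) IH; rewrite ler_norml => /andP[_].
  move: (flux_density _ _ _) (flux_density _ _ _) (flux_density _ _ _) => a b c.
  by move: (\sum_(j < n) _) (g * _) => e e'; lra.
apply: le_trans; rewrite lerD2l lerN2 -mulr_sumr mulrC ler_pM2r//.
exact: sum_half_powers.
Qed.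

Lemma osc_not_differentiable_of_flux x (V : {vspace 'rV[R]_d}) :
  `|x| <= rho -> sigma x \in V ->
  (forall j, excess_weight j * sqdist (f j) (f j.+1) x <= 1) ->
  202 * g < flux_density sigma (f 0%N) x ->
  ~ differentiable_along (osc f rho) x V.
Proof.
move=> xB xV t1 big.
have s0 j : 0 < s j by case: (sP j).
have sdec j : s j.+1 <= s j by case: (sP j).
have shalf j : s j <= half ^+ j by case: (sP j).
have fC j : C11 (f j) (L j) by case: (fL j).
have Ls j : d%:R * L j * s j.+1 <= g * half ^+ j by case: (fL j).
apply: (osc_not_differentiable g_gt0 g_le s0 sdec shalf fC Ls fsmall
  grad1_pair_diff_le1 xB (sigma_le1 x) _ _ xV).
- move=> k; rewrite grad1_pair_diff_le//; apply: le_trans (partial_sum_small _) _.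
    exact: t1.
  rewrite ler_pM2l// ler_wiXn2l ?invr_ge0 ?invf_le1 ?ler1n//.
  by rewrite -addnn leq_addr.
- move=> k; have := slope_persists k.*2 t1.
  have -> : \sum_i partial i (f k.*2) x * sigma x 0 i =
      flux_density sigma (f k.*2) x by apply: eq_bigr => i _; rewrite mulrC.
  move: big; move: (flux_density _ _ _) (flux_density _ _ _) => a b; lra.
Qed.

Lemma osc_pair_lipschitz : lipschitz (osc f rho).
Proof.
have s0 j : 0 < s j by case: (sP j).
have sdec j : s j.+1 <= s j by case: (sP j).
have shalf j : s j <= half ^+ j by case: (sP j).
have fC j : C11 (f j) (L j) by case: (fL j).
have Ls j : d%:R * L j * s j.+1 <= g * half ^+ j by case: (fL j).
exact: (osc_lipschitz g_gt0 g_le s0 sdec shalf fC Ls fsmall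
  grad1_pair_diff_le1).
Qed.

(** Where the series is less than one, all the gradients are close together
and a flux density above [202 * g] would make [osc] non-differentiable along
[W x]; where it is at least one, it dominates the flux density. An inequality of
this kind can be integrated, which replaces the choice of a set of positive
measure on which the gradients converge uniformly. *)
Lemma flux_density_le_excess :
  {ae mu, forall x, B x -> ((flux_density sigma (f 0%N) x)%:E <=
    (202 * g)%:E +
    \sum_(j <oo) (excess_weight j * sqdist (f j) (f j.+1) x)%:E)%E}.
Proof.
apply: ae_mono2 sigma_W (W_diff osc_pair_lipschitz) => x Wx udiff xB.
have term_ge0 j : (0 <= (excess_weight j * sqdist (f j) (f j.+1) x)%:E)%E.
  by rewrite lee_fin mulr_ge0 ?sqr_ge0// sqdist_ge0.
rewrite leNgt; apply/negP.
set Phi := limn _ => big.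
have Phi_ge0 : (0 <= Phi)%E by apply: nneseries_ge0 => j _ _; exact: term_ge0.
have flux1 : ((flux_density sigma (f 0%N) x)%:E <= 1)%E.
  rewrite lee_fin; have := flux_density_le sigma_le1 x (fb 0%N).
  exact: le_trans (ler_norm _).
have Phi1 : (Phi < 1)%E.
  rewrite ltNge; apply/negP => Phi1.
  have := lt_le_trans big flux1; apply/negP; rewrite -leNgt.
  by apply: (le_trans Phi1); rewrite leeDr// lee_fin mulr_ge0// (ltW g_gt0).
have fluxbig : 202 * g < flux_density sigma (f 0%N) x.
  by rewrite -lte_fin; apply: le_lt_trans big; rewrite leeDl.
apply: (osc_not_differentiable_of_flux xB Wx _ fluxbig udiff) => j.
rewrite -lee_fin; apply: le_trans (ltW Phi1).
rewrite /Phi (nneseriesD1 (n := j))//.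
by rewrite leeDl//; apply: nneseries_ge0 => k _ _; exact: term_ge0.
Qed.

End Excess.

End LargeFlux.

(** * Small functions have a small flux *)

Section Integration.
Context {R : realType} {d : nat}.
Context (mu : {measure set (borel_rV R d) -> \bar R}).
Implicit Types (f : 'rV[R]_d -> R).

Lemma Rintegral_le_of_ae_series (B : set (borel_rV R d)) f
    (h : nat -> 'rV[R]_d -> R) (C b : nat -> R) (c beta : R) :
  measurable B -> (mu B < +oo)%E ->
  measurable_fun setT (f : borel_rV R d -> R) -> (forall x, `|f x| <= 1) ->
  (forall j, measurable_fun setT (h j : borel_rV R d -> R)) ->
  (forall j x, 0 <= h j x) -> (forall j x, h j x <= C j) ->
  (forall j, \int[mu]_(x in B) h j x <= b j) ->
  (forall n, \sum_(j < n) b j <= beta) -> 0 <= c ->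
  {ae mu, forall x, B x -> ((f x)%:E <= c%:E + \sum_(j <oo) (h j x)%:E)%E} ->
  \int[mu]_(x in B) f x <= c * fine (mu B) + beta.
Proof.
move=> mB Bfin mf f1 mh h0 hC hb bb c0 fh.
pose fp x := Num.max (f x) 0.
have fp1 x : `|fp x| <= 1.
  by rewrite /fp; case: (leP (f x) 0) => _; rewrite ?normr0.
have mfp : measurable_fun setT (fp : borel_rV R d -> R).
  by apply: measurable_maxr => //; exact: measurable_cst.
have If := integrable_bounded mB Bfin mf f1.
have Ifp := integrable_bounded mB Bfin mfp fp1.
have Ih j : mu.-integrable B (EFin \o (h j : borel_rV R d -> R)).
  by apply: (integrable_bounded (C := C j)) => // x; rewrite ger0_norm.
apply: (@le_trans _ _ (\int[mu]_(x in B) fp x)).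
  by apply: le_Rintegral => // x _; rewrite /fp le_max lexx.
rewrite -lee_fin /Rintegral fineK; last exact: integrable_fin_num.
have mS j : measurable_fun B (EFin \o (h j : borel_rV R d -> R)).
  by apply/measurable_EFinP; exact: measurable_funS (mh j).
have Phi0 x : (0 <= \sum_(j <oo) (h j x)%:E)%E.
  by apply: nneseries_ge0 => j _ _; rewrite lee_fin.
have mPhi : measurable_fun B (fun x : borel_rV R d => \sum_(j <oo) (h j x)%:E)%E.
  apply: (@ge0_emeasurable_sum _ _ _ B (fun j x => (h j x)%:E) xpredT).
    by move=> j x _ _; rewrite lee_fin.
  by move=> j _; exact: mS.
apply: (@le_trans _ _
    (\int[mu]_(x in B) (c%:E + \sum_(j <oo) (h j x)%:E))%E).
  apply: ae_ge0_le_integral => //.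
  - by move=> x _; rewrite lee_fin /fp le_max lexx orbT.
  - by apply/measurable_EFinP; exact: measurable_funS mfp.
  - by move=> x _; rewrite adde_ge0.
  - by apply: emeasurable_funD => //; exact: measurable_cst.
  - refine (ae_mono2 _ fh fh) => x fx _ xB.
    by rewrite /fp /= EFin_max ge_max fx//= adde_ge0.
rewrite ge0_integralD//.
rewrite integral_cst// EFinD leeD//.
  by rewrite EFinM fineK// ge0_fin_numE.
rewrite integral_nneseries//; last by move=> j x _; rewrite lee_fin.
apply: lime_le.
  apply: is_cvg_nneseries => j _ _; apply: integral_ge0 => x _.
  by rewrite lee_fin.
apply: nearW => n; rewrite big_mkord.
apply: le_trans (_ : ((\sum_(j < n) b j)%:E <= _)%E); last by rewrite lee_fin.
rewrite -sumEFin; apply: lee_sum => j _.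
rewrite -[leLHS]fineK; last exact: (integrable_fin_num mB (Ih j)).
by rewrite lee_fin; exact: hb.
Qed.

End Integration.

Section FluxSmall.
Context {R : realType} {d : nat}.
Context (mu : {measure set (borel_rV R d) -> \bar R}) (rho : R).
Context (sigma : 'rV[R]_d -> 'rV[R]_d).
Context (W : 'rV[R]_d -> {vspace 'rV[R]_d}).

Local Notation B := (cball rho : set (borel_rV R d)).
Local Notation half := (2^-1 : R).

(** Otherwise there are functions with flux at least [eps] that are as small as
one likes. An almost minimizing sequence of these has flux density at most
[202 * g] plus a series of integral at most [eps / 4], so that its first term
has flux at most [3 * eps / 4]. *)
Lemma flux_small (eps : R) :
  (mu B < +oo)%E ->
  (forall i, measurable_fun setT (fun x : borel_rV R d => sigma x 0 i)) ->
  (forall x, `|sigma x| <= 1) ->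
  {ae mu, forall x, sigma x \in W x} ->
  (forall u : 'rV[R]_d -> R, lipschitz u ->
     {ae mu, forall x, differentiable_along u x (W x)}) ->
  0 < eps ->
  exists2 eta : R, 0 < eta & forall f, bounded_slope f ->
    (forall x, `|x| <= rho + 2 -> `|f x| <= eta) -> flux mu rho sigma f < eps.
Proof.
move=> Bfin sm s1 sW Wd eps0; apply: contrapT => nsmall.
have adm (eta : R) : 0 < eta -> exists f, admissible mu rho sigma eps eta f.
  move=> eta0; apply: contrapT => nadm; apply: nsmall; exists eta => // f fb fe.
  by rewrite ltNge; apply/negP => fl; apply: nadm; exists f.
have [m [mE m0]] : exists m, fine (mu B) = m /\ 0 <= m.
  by exists (fine (mu B)); split => //; apply: fine_ge0.
pose g := Num.min 4^-1 (eps / (404 * (m + 1))).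
have m1 : 0 < 404 * (m + 1) by lra.
have g0 : 0 < g by rewrite lt_min invr_gt0 divr_gt0// ltr0n.
have g4 : g <= 4^-1 by rewrite ge_min lexx.
have gm : 202 * g * m <= eps / 2.
  have : g * (404 * (m + 1)) <= eps.
    by rewrite -ler_pdivlMr// ge_min lexx orbT.
  by have := ltW g0; lra.
have too_small : 202 * g * m + eps / 4 < eps by lra.
have half_gt0 j : 0 < half ^+ j by rewrite exprn_gt0// invr_gt0.
have half_dec j : half ^+ j.+1 <= half ^+ j.
  by rewrite exprS; have := half_gt0 j; move: (half ^+ j) => t t0; lra.
have d1 : 0 < d%:R + 1 :> R by rewrite ltr_wpDl.
(* Makes the integral of the term [j] of the excess series at most
[eps / 8 * half ^+ j]. *)
pose kappa j := eps / 64 * half ^+ j * (g * half ^+ j / (d%:R + 1)) ^+ 2.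
have kappa0 j : 0 < kappa j.
  by rewrite !mulr_gt0 ?exprn_gt0 ?divr_gt0 ?mulr_gt0 ?ltr0n.
have kappa_dec j : kappa j.+1 <= kappa j.
  have e0 : 0 <= eps / 64 by rewrite divr_ge0// ltW.
  have q0 i : 0 <= g * half ^+ i / (d%:R + 1).
    by rewrite divr_ge0 ?mulr_ge0// ltW.
  apply: ler_pM.
  - by rewrite mulr_ge0// ltW.
  - by rewrite sqr_ge0.
  - by rewrite ler_wpM2l.
  - by rewrite lerXn2r ?nnegrE// ler_pM2r ?invr_gt0// ler_pM2l.
have g1 : g <= 1 by move: g4; lra.
have [f [L [s [sP fL fsmall fb [f0 fQ]]]]] :=
  minimizing_sequence Bfin sm s1 adm g0 g1 kappa0 kappa_dec.
have ae := flux_density_le_excess s1 sW Wd g0 g4 sP fL fsmall fb.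
pose C := d%:R * (2 * @slope_bound R d) ^+ 2.
have ew0 j : 0 <= @excess_weight R d g j by rewrite sqr_ge0.
have mB : measurable B by exact: cball_measurable.
have Iq j : mu.-integrable B (EFin \o (sqdist (f j) (f j.+1) : borel_rV R d -> R)).
  apply: (integrable_bounded (C := C)) => //; first exact: sqdist_meas.
  by move=> x; rewrite ger0_norm ?sqdist_ge0// sqdist_le.
have := @Rintegral_le_of_ae_series R d mu B (flux_density sigma (f 0%N))
  (fun j x => @excess_weight R d g j * sqdist (f j) (f j.+1) x)
  (fun j => @excess_weight R d g j * C) (fun j => eps / 8 * half ^+ j)
  (202 * g) (eps / 4) mB Bfin (flux_density_meas sm (fL 0%N).1)
  (fun x => flux_density_le s1 x (fb 0%N)).
rewrite mE => /(_ _ _ _ _ _ _ ae) H.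
apply/negP: too_small; rewrite -leNgt; apply: (le_trans f0); apply: H.
- move=> j; apply: measurable_funM; first exact: measurable_cst.
  exact: sqdist_meas.
- by move=> j x; rewrite mulr_ge0// sqdist_ge0.
- by move=> j x; rewrite ler_wpM2l// sqdist_le.
- move=> j; rewrite RintegralZl//.
  apply: (@le_trans _ _ (@excess_weight R d g j * (8 * kappa j))).
    by rewrite ler_wpM2l.
  rewrite /excess_weight /kappa le_eqVlt; apply/orP; left; apply/eqP.
  by field; rewrite !gt_eqF// ?exprn_gt0.
- move=> n; rewrite -mulr_sumr.
  apply: (@le_trans _ _ (eps / 8 * 2)); last by lra.
  by rewrite ler_wpM2l ?sum_half_powers// divr_ge0// ltW.
- by rewrite mulr_ge0// ltW.
Qed.

End FluxSmall.

(** * Test functions *)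

Section TestFunctions.
Context {R : realType} {d : nat}.
Implicit Types (phi psi u : 'rV[R]_d -> R) (x y : 'rV[R]_d).

Lemma supp_out u x : ~ supp u x -> \forall y \near x, u y = 0.
Proof.
move=> xu; have : open (~` supp u) by apply: closed_openC; exact: closed_closure.
rewrite openE => /(_ x xu); apply: filterS => y yu.
by apply: contrapT => /eqP uy; apply: yu; exact: subset_closure.
Qed.

Lemma partial_out u i x : ~ supp u x -> partial i u x = 0.
Proof.
move=> /supp_out u0; rewrite /partial (@near_eq_derive _ _ _ u (cst 0))//.
exact: derive_cst.
Qed.

Lemma supp_partial u i : supp (partial i u) `<=` supp u.
Proof.
rewrite ((closure_id (supp u)).1 (@closed_closure _ _)).
apply: closure_subset => x /= xu; apply: contrapT => /(@partial_out u i) u0.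
by rewrite u0 eqxx in xu.
Qed.

Lemma bounded_of_compact_supp u (K : set 'rV[R]_d) : compact K -> continuous u ->
  (forall x, ~ K x -> u x = 0) -> exists C : R, forall x, `|u x| <= C.
Proof.
move=> cK cu uK.
have : compact (u @` K).
  by apply: continuous_compact => //; exact: continuous_subspaceT.
move=> /compact_bounded[M [_ HM]].
exists (Num.max (M + 1) 0) => x; rewrite le_max.
have [xK|/uK->] := pselect (K x); last by rewrite normr0 lexx orbT.
by rewrite (HM (M + 1)) ?ltrDl//; exists x.
Qed.

(** The second partial derivatives are continuous with compact support, hence
bounded, so the first ones are Lipschitz. *)
Lemma test_function_C11 phi : test_function phi -> bounded_C11 phi.
Proof.
move=> [phiC phiK].
have [_ /= d2] := phiC 2%N.
have out i x : ~ supp phi x -> partial i phi x = 0 by exact: partial_out.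
have cont i : continuous (partial i phi) by case: (d2 i) => _ [].
have bd1 i : exists C : R, forall x, `|partial i phi x| <= C.
  exact: bounded_of_compact_supp phiK (cont i) (out i).
have bd2 (p : 'I_d * 'I_d) :
    exists C : R, forall x, `|partial p.2 (partial p.1 phi) x| <= C.
  have [_ [_ /(_ p.2)[_ [c2 _]]]] := d2 p.1.
  apply: bounded_of_compact_supp phiK c2 _ => x xK.
  by apply: partial_out => /supp_partial.
have /choice[C1 C1P] := bd1; have /choice[C2 C2P] := bd2.
have max_le (I : finType) (C : I -> R) i : C i <= \sum_j `|C j|.
  by rewrite (bigD1 i)//= ler_wpDr ?ler_norm// sumr_ge0.
split; last first.
  by exists (\sum_j `|C1 j|) => i x; apply: le_trans (C1P i x) _; exact: max_le.
exists ((\sum_j `|C2 j|) * d%:R); split; first by rewrite mulr_ge0// sumr_ge0.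
  by move=> z i; case: (d2 i).
move=> x y i; apply: lipschitz_of_partial_le.
  by move=> z j; have [_ [_ /(_ j)[]]] := d2 i.
by move=> z j; apply: le_trans (C2P (i, j) z) _; exact: max_le.
Qed.

Lemma uniform_cvg_on_balls (phi : nat -> 'rV[R]_d -> R) (K c r eta : R) :
  (forall n x y, `|phi n y - phi n x| <= K * `|y - x|) ->
  (forall x, phi n x @[n --> \oo] --> c) -> 0 < eta ->
  \forall n \near \oo, forall x, `|x| <= r -> `|phi n x - c| <= eta.
Proof.
move=> phiK phic eta0.
have cov := (compact_near_coveringP (cball r)).1 (@cball_compact R d r).
apply: (cov _ \oo (fun n x => `|phi n x - c| <= eta)) => x _.
pose del := eta / 2 / (`|K| + 1).
have K1 : 0 < `|K| + 1 by rewrite ltr_wpDl.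
have e2 : 0 < eta / 2 by rewrite divr_gt0.
have del0 : 0 < del by rewrite divr_gt0.
exists (ball x del, [set n | `|phi n x - c| < eta / 2]).
  split; first exact: nbhsx_ballx.
  have /cvgrPdist_lt/(_ _ e2) := phic x; apply: filterS => n /=.
  by rewrite distrC.
move=> [y n] /= [yx pn]; move: yx; rewrite -ball_normE /= distrC => yx.
rewrite (_ : _ - _ = (phi n y - phi n x) + (phi n x - c)); last by ring.
apply: le_trans (ler_normD _ _) _.
have : `|phi n y - phi n x| <= eta / 2.
  apply: (le_trans (phiK n x y)).
  apply: (@le_trans _ _ ((`|K| + 1) * `|y - x|)).
    by rewrite ler_wpM2r// (le_trans (ler_norm K))// lerDl.
  by rewrite mulrC -ler_pdivlMr// ltW.
by move: pn; lra.
Qed.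

End TestFunctions.

(** * Bounded fields with values in W are tangent *)

Section Tangent.
Context {R : realType} {d : nat}.
Context (mu : {measure set (borel_rV R d) -> \bar R}) (rho : R).
Context (sigma : 'rV[R]_d -> 'rV[R]_d).
Context (W : 'rV[R]_d -> {vspace 'rV[R]_d}).
Implicit Types (phi psi : 'rV[R]_d -> R).

Local Notation B := (cball rho : set (borel_rV R d)).

Hypothesis B_fin : (mu B < +oo)%E.
Hypothesis sigma_meas :
  forall i, measurable_fun setT (fun x : borel_rV R d => sigma x 0 i).
Hypothesis sigma_le1 : forall x, `|sigma x| <= 1.
Hypothesis sigma_out : forall x, ~ cball rho x -> sigma x = 0.
Hypothesis sigma_W : {ae mu, forall x, sigma x \in W x}.
Hypothesis W_diff : forall u : 'rV[R]_d -> R, lipschitz u ->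
  {ae mu, forall x, differentiable_along u x (W x)}.

Let mB : measurable B. Proof. exact: cball_measurable. Qed.

Lemma opp_divE phi : opp_div mu sigma phi = flux mu rho sigma phi.
Proof.
rewrite /opp_div /flux [RHS]Rintegral_mkcond; apply: eq_Rintegral => x _.
rewrite patchE; case: ifPn => [_|/negP xB].
  by apply: eq_bigr => i _; rewrite mxE.
rewrite sigma_out; last by move=> h; apply: xB; rewrite inE.
by rewrite big1// => i _; rewrite mxE mul0r.
Qed.

Lemma bounded_field_L1 : L1_field mu sigma.
Proof.
move=> i; have : mu.-integrable B (EFin \o (fun x : borel_rV R d => sigma x 0 i)).
  apply: (integrable_bounded (C := 1)) => // x.
  exact: le_trans (coord_le_norm _ _) (sigma_le1 x).
move=> /(integrable_mkcond _ mB).1; congr (mu.-integrable _ _).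
apply/funext => x; rewrite patchE; case: ifPn => // /negP xB.
by rewrite sigma_out ?mxE// => h; apply: xB; rewrite inE.
Qed.

Lemma opp_div_distribution : Defs.distribution (opp_div mu sigma).
Proof.
split.
  move=> a phi psi /test_function_C11 phiC /test_function_C11 psiC.
  rewrite !opp_divE.
  have := flux_lin B_fin sigma_meas sigma_le1 a 1 phiC psiC.
  rewrite mul1r => <-; congr (flux _ _ _ _).
  by apply/funext => x; rewrite mul1r.
move=> K _; exists 1%N, (d%:R * fine (mu B)) => phi S phiT _ HS.
rewrite opp_divE /flux; have phiC := test_function_C11 phiT.
have Iphi := flux_density_integrable B_fin sigma_meas sigma_le1 phiC.
have dS x : `|flux_density sigma phi x| <= d%:R * S.
  by apply: flux_density_le_sum => // i; exact: (HS [:: i] x).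
apply: le_trans (le_normr_Rintegral mB Iphi) _.
rewrite mulrAC -Rintegral_cst//; apply: le_Rintegral => //.
- by have := integrable_abse Iphi.
- apply: (integrable_bounded (C := `|d%:R * S|)) => //.
Qed.

(** On a ball around the support of [sigma] the functions [phi n - c] become
uniformly small, and after scaling their slopes are bounded as required by
[flux_small]; the two signs bound the flux on both sides. *)
Lemma opp_div_continuous (phi : nat -> 'rV[R]_d -> R) (C c : R) :
  (forall n, test_function (phi n)) -> (forall n x, `|grad (phi n) x| <= C) ->
  (forall x, phi n x @[n --> \oo] --> c) ->
  opp_div mu sigma (phi n) @[n --> \oo] --> (0 : R).
Proof.
move=> phiT phiC phic.
have phib n := test_function_C11 (phiT n).
have pC n i x : `|partial i (phi n) x| <= C.
  by apply: le_trans (phiC n x); have := coord_le_norm (grad (phi n) x) i; rewrite mxE.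
have C1 : 0 < `|C| + 1 by rewrite ltr_wpDl.
pose a := @slope_bound R d / (`|C| + 1).
have a0 : 0 < a by rewrite divr_gt0// slope_bound_gt0.
apply/cvgrPdist_lt => e e0.
have [eta eta0 small] := flux_small B_fin sigma_meas sigma_le1 sigma_W W_diff
  (mulr_gt0 a0 e0).
have lip n x y : `|phi n y - phi n x| <= C * d%:R * `|y - x|.
  apply: lipschitz_of_partial_le => [z i|z i]; last exact: pC.
  by have [[L [_ + _]] _] := phib n.
have := uniform_cvg_on_balls (rho + 2) lip phic (divr_gt0 eta0 a0).
apply: filterS => n phin; rewrite sub0r normrN opp_divE.
have cstb : @bounded_C11 R d (fun=> 1).
  split; first by exists 0; exact: C11_cst.
  by exists 0 => i x; rewrite partial_cst normr0.
have cst0 : flux mu rho sigma (fun=> 1) = 0.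
  rewrite /flux (@eq_Rintegral _ _ _ _ _ (cst 0)) ?Rintegral_cst ?mul0r//.
  by move=> x _; rewrite /flux_density big1// => i _; rewrite partial_cst mulr0.
have signed b : `|b| = a -> b * flux mu rho sigma (phi n) < a * e.
  move=> ba; have := flux_lin B_fin sigma_meas sigma_le1 b (- b * c) (phib n) cstb.
  rewrite cst0 mulr0 addr0 => <-; apply: small.
    split; first by case: (phib n) => -[L pL] _; eexists; exact: C11_lin pL (C11_cst 1).
    move=> i x; rewrite partial_lin//; last first.
      by have [[L [_ + _]] _] := phib n.
    rewrite partial_cst mulr0 addr0 normrM ba.
    apply: (@le_trans _ _ (a * (`|C| + 1))); last by rewrite divfK// gt_eqF.
    rewrite ler_pM2l//; apply: le_trans (pC n i x) _.
    by rewrite (le_trans (ler_norm C))// lerDl.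
  move=> x xr; rewrite mulr1 mulNr -mulrBr normrM ba.
  by rewrite mulrC -ler_pdivlMr//; exact: phin.
rewrite ltr_norml -(ltr_pM2l a0) -(ltr_pM2l a0 _ e).
have s1 := signed a (gtr0_norm a0).
have s2 := signed (- a); rewrite normrN gtr0_norm// in s2.
have {}s2 := s2 erefl; rewrite s1 andbT mulrN -mulrN.
by rewrite mulrN ltrNl -mulNr.
Qed.

Lemma bounded_field_tangent : tangent_field mu sigma.
Proof.
split; first exact: bounded_field_L1.
split; first exact: opp_div_distribution.
move=> phi phiT [C phiC] [c phic]; exact: opp_div_continuous phiT phiC phic.
Qed.

End Tangent.

(** * Orthogonal projections onto varying subspaces *)

Section Projection.
Context {R : realType} {d : nat}.
Implicit Types (x y z p q v w : 'rV[R]_d) (V U : {vspace 'rV[R]_d}).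

Definition dot x y : R := \sum_i x 0 i * y 0 i.

Lemma dotC x y : dot x y = dot y x.
Proof. by apply: eq_bigr => i _; rewrite mulrC. Qed.

Lemma dotDl x y z : dot (x + y) z = dot x z + dot y z.
Proof. by rewrite -big_split/=; apply: eq_bigr => i _; rewrite mxE mulrDl. Qed.

Lemma dotZl (a : R) x y : dot (a *: x) y = a * dot x y.
Proof. by rewrite mulr_sumr; apply: eq_bigr => i _; rewrite mxE mulrA. Qed.

Lemma dotBl x y z : dot (x - y) z = dot x z - dot y z.
Proof. by rewrite dotDl -scaleN1r dotZl mulN1r. Qed.

Lemma dotBr x y z : dot x (y - z) = dot x y - dot x z.
Proof. by rewrite dotC dotBl !(dotC x). Qed.

Lemma dot0l y : dot 0 y = 0.
Proof. by rewrite /dot big1// => i _; rewrite mxE mul0r. Qed.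

Lemma dot_suml (I : finType) (F : I -> 'rV[R]_d) y :
  dot (\sum_i F i) y = \sum_i dot (F i) y.
Proof.
by elim/big_rec2: _ => [|i a b _ <-]; rewrite ?dot0l// dotDl.
Qed.

Lemma dotxx_ge0 x : 0 <= dot x x.
Proof. by apply: sumr_ge0 => i _; rewrite -expr2 sqr_ge0. Qed.

Lemma coord_sqr_le_dot x i : x 0 i ^+ 2 <= dot x x.
Proof.
rewrite /dot (bigD1 i)//= -expr2 lerDl sumr_ge0// => j _.
by rewrite -expr2 sqr_ge0.
Qed.

Lemma dotxx_eq0 x : dot x x = 0 -> x = 0.
Proof.
move=> x0; apply/rowP => i; rewrite mxE; apply/eqP; rewrite -sqrf_eq0.
by rewrite eq_le sqr_ge0 -x0 coord_sqr_le_dot.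
Qed.

Lemma norm_le1_of_dot x : dot x x <= 1 -> `|x| <= 1.
Proof.
move=> x1; apply: norm_le_coord => // i.
rewrite -(@ler_pXn2r _ 2)// ?nnegrE// expr1n real_normK ?num_real//.
exact: le_trans (coord_sqr_le_dot x i) x1.
Qed.

Lemma dot_le x y : `|dot x y| <= d%:R * (`|x| * `|y|).
Proof.
apply: le_trans (ler_norm_sum _ _ _) _.
apply: (@le_trans _ _ (\sum_(i < d) `|x| * `|y|)).
  by apply: ler_sum => i _; rewrite normrM ler_pM// coord_le_norm.
by rewrite sumr_const card_ord mulr_natl.
Qed.

Definition orth_proj V x p : Prop :=
  p \in V /\ forall w, w \in V -> dot (x - p) w = 0.

(** One step of the Gram-Schmidt process for each vector of [X]. *)
Lemma orth_proj_span (X : seq 'rV[R]_d) x : exists p, orth_proj <<X>> x p.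
Proof.
elim: X x => [|v X IH] x.
  exists 0; split; first by rewrite mem0v.
  by move=> w; rewrite span_nil memv0 => /eqP ->; rewrite dotC dot0l.
have [p0 [p0X xp0]] := IH x; have [pv [pvX vpv]] := IH v.
pose v' := v - pv; pose c := dot x v' / dot v' v'.
exists (p0 + c *: v'); rewrite span_cons; split.
  rewrite /v' scalerBr addrCA; apply: memv_add.
    by apply: memvZ; exact: memv_line.
  by apply: memvB => //; apply: memvZ.
have cE : dot x v' - c * dot v' v' = 0.
  have [v0|v0] := eqVneq (dot v' v') 0.
    by rewrite (dotxx_eq0 v0) dotC !dot0l mulr0 subrr.
  by rewrite /c divfK// subrr.
have orthX w : w \in <<X>>%VS -> dot (x - (p0 + c *: v')) w = 0.
  move=> wX; rewrite opprD addrA dotBl xp0// dotZl.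
  by rewrite (vpv w wX) mulr0 subrr.
have orthv : dot (x - (p0 + c *: v')) v' = 0.
  rewrite opprD addrA dotBl dotZl dotBl (dotC p0) (vpv _ p0X) subr0.
  exact: cE.
move=> w /memv_addP[u /vlineP[k ->] [y yX ->]].
have -> : k *: v + y = k *: v' + (k *: pv + y).
  by rewrite /v' scalerBr addrA subrK.
rewrite dotC dotDl dotZl dotC orthv mulr0 add0r dotC orthX//.
by apply: memvD => //; apply: memvZ.
Qed.

Lemma orth_proj_ex V x : exists p, orth_proj V x p.
Proof. by rewrite -(span_basis (vbasisP V)); exact: orth_proj_span. Qed.

Definition proj V x := xget 0 [set p | orth_proj V x p].

Lemma projP V x : orth_proj V x (proj V x).
Proof.
have [p pP] := orth_proj_ex V x.
by rewrite /proj; case: xgetP => // /(_ p).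
Qed.

Lemma proj_dot_le V x : dot (proj V x) (proj V x) <= dot x x.
Proof.
have [pV /(_ _ pV) xp] := projP V x; set p := proj V x in pV xp *.
have := dotxx_ge0 (x - p); rewrite dotBr xp subr0 dotBl (dotC p x).
by move: xp; rewrite dotBl; lra.
Qed.

Lemma proj_compl_dot_le V x : dot (x - proj V x) (x - proj V x) <= dot x x.
Proof.
have [pV /(_ _ pV) xp] := projP V x; set p := proj V x in pV xp *.
have := dotxx_ge0 p; rewrite dotBr xp subr0 dotBl (dotC p x).
by move: xp; rewrite dotBl; lra.
Qed.

(** The projection depends continuously on the subspace: testing
[proj V x - proj U x] against itself, only the gap between the two subspaces
remains, by orthogonality. *)
Lemma proj_close (e : R) V U x : 0 <= e -> dot x x <= 1 -> gr_close e V U ->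
  dot (proj V x - proj U x) (proj V x - proj U x) <= 2 * d%:R * e.
Proof.
move=> e0 x1 [VU UV].
have [pV xp] := projP V x; have [pU xp'] := projP U x.
have p1 : `|proj V x| <= 1.
  by apply: norm_le1_of_dot; apply: le_trans (proj_dot_le _ _) x1.
have p1' : `|proj U x| <= 1.
  by apply: norm_le1_of_dot; apply: le_trans (proj_dot_le _ _) x1.
have c1 : `|x - proj V x| <= 1.
  by apply: norm_le1_of_dot; apply: le_trans (proj_compl_dot_le _ _) x1.
have c1' : `|x - proj U x| <= 1.
  by apply: norm_le1_of_dot; apply: le_trans (proj_compl_dot_le _ _) x1.
set p := proj V x in pV xp p1 c1 *; set p' := proj U x in pU xp' p1' c1' *.
have [q' q'U pq'] := VU _ pV; have [q qV p'q] := UV _ pU.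
have -> : dot (p - p') (p - p') = dot (x - p) (p' - q) + dot (x - p') (p - q').
  have -> : dot (p - p') (p - p') = dot (x - p') (p - p') - dot (x - p) (p - p').
    have xpp : p - p' = (x - p') - (x - p) by rewrite opprB [RHS]addrC addrA subrK.
    by rewrite -dotBl -xpp.
  by rewrite !dotBr (xp _ pV) (xp _ qV) (xp' _ pU) (xp' _ q'U); ring.
have d0 : 0 <= d%:R :> R by [].
have bd (a b c : 'rV[R]_d) : `|a| <= 1 -> `|b| <= e * `|c| -> `|c| <= 1 -> dot a b <= d%:R * e.
  move=> a1 be c1''; apply: le_trans (ler_norm _) _; apply: le_trans (dot_le _ _) _.
  rewrite ler_wpM2l// -[leRHS]mul1r ler_pM//; apply: (le_trans be).
  by rewrite ler_piMr.
have := bd _ _ _ c1 p'q p1'; have := bd _ _ _ c1' pq' p1; lra.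
Qed.

Lemma proj_coord_open (x : 'rV[R]_d) i (a : R) : dot x x <= 1 ->
  gr_open [set V | proj V x 0 i < a].
Proof.
move=> x1 V /= Va; pose t := a - proj V x 0 i.
have t0 : 0 < t by rewrite subr_gt0.
have d1 : 0 < 2 * d%:R + 1 :> R by rewrite ltr_wpDl.
exists (t ^+ 2 / (2 * d%:R + 1)) => [|U VU]; first by rewrite divr_gt0// exprn_gt0.
have e0 : 0 <= t ^+ 2 / (2 * d%:R + 1) by rewrite divr_ge0 ?sqr_ge0// ltW.
have pc := proj_close e0 x1 VU.
have lt2 : 2 * d%:R * (t ^+ 2 / (2 * d%:R + 1)) < t ^+ 2.
  by rewrite mulrA ltr_pdivrMr// mulrC ltr_pM2l ?exprn_gt0// ltrDl.
have := coord_sqr_le_dot (proj V x - proj U x) i.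
move=> /le_trans/(_ pc)/le_lt_trans/(_ lt2).
rewrite -real_normK ?num_real// ltr_pXn2r// ?nnegrE ?(ltW t0)//.
by rewrite ltr_norml !mxE /t => /andP[? ?]; lra.
Qed.

Lemma dot_delta (i : 'I_d) : dot (delta_mx 0 i) (delta_mx 0 i) = 1.
Proof.
rewrite /dot (bigD1 i)//= big1 => [|j ji]; first by rewrite !mxE !eqxx/= mulr1 addr0.
by rewrite !mxE (negbTE ji) andbF mulr0.
Qed.

Lemma subv_of_proj V U :
  (forall i, proj V (delta_mx 0 i) \in U) -> (V <= U)%VS.
Proof.
move=> PU; apply/subvP => w wV.
pose z := \sum_i w 0 i *: proj V (delta_mx 0 i).
have zV : z \in V.
  by apply: memv_suml => i _; apply: memvZ; case: (projP V (delta_mx 0 i)).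
suff -> : w = z by apply: memv_suml => i _; exact: memvZ.
apply/eqP; rewrite -subr_eq0; apply/eqP/dotxx_eq0.
have wz : w - z \in V by apply: memvB.
have -> : dot (w - z) (w - z) =
    dot (\sum_i w 0 i *: (delta_mx 0 i - proj V (delta_mx 0 i))) (w - z).
  congr (dot _ _); rewrite {1}[w]row_sum_delta -sumrB.
  by apply: eq_bigr => i _; rewrite scalerBr.
rewrite dot_suml big1// => i _; rewrite dotZl.
by have [_ ->] := projP V (delta_mx 0 i); rewrite ?mulr0.
Qed.

End Projection.

(** * Borel versions of measurable families *)

Section BorelVersion.
Context {R : realType} {d : nat}.
Context (mu : {measure set (borel_rV R d) -> \bar R}).

Lemma ae_forall_countable (I : countType) (P : I -> 'rV[R]_d -> Prop) :
  (forall i, {ae mu, forall x, P i x}) -> {ae mu, forall x, forall i, P i x}.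
Proof.
move=> aP.
pose Q n (x : borel_rV R d) := if unpickle n is Some i then P i x else True.
have aQ n : {ae mu, forall x, Q n x}.
  by rewrite /Q; case: unpickle => [i|]; [exact: aP|exact: aeW].
have aQn := ae_foralln aQ.
refine (ae_mono2 _ aQn aQn) => x Qx _ i.
by have := Qx (pickle i); rewrite /Q pickleK.
Qed.

(** Measurability with respect to the completion is a condition on countably
many sublevel sets; off a null Borel set that contains all their exceptional
sets, each sublevel set with a rational bound is the trace of a Borel set. *)
Lemma borel_version (I : countType) (h : I -> 'rV[R]_d -> R) :
  (forall i (a : R), mu_measurable mu [set x | h i x < a]) ->
  exists N : set (borel_rV R d), [/\ measurable N, mu N = 0 &
    forall i, measurable_fun (~` N) (h i : borel_rV R d -> R)].
Proof.
move=> hm.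
have /choice[F FP] : forall p : I * rat, exists F : set (borel_rV R d),
    measurable F /\
    mu.-negligible ([set x : borel_rV R d | h p.1 x < ratr p.2] `+` F).
  by move=> p; have [F mF nF] := hm p.1 (ratr p.2); exists F.
have ae : {ae mu, forall x, forall p : I * rat,
    (h p.1 x < ratr p.2 : Prop) <-> F p x}.
  apply: ae_forall_countable => p; have [_ nF] := FP p.
  rewrite setY_def in nF; apply: negligibleS nF => x /= nx.
  apply: contrapT => /not_orP[/= n1 n2]; apply: nx; split => Hx.
    by apply: contrapT => nFx; apply: n1.
  by apply: contrapT => nhx; apply: n2.
have [N [mN N0 sN]] := ae.
exists N; split => // i; apply: (measurability _ (RGenInftyO.measurableE R)).
move=> _ [_ [a ->] <-].
have mNC : measurable (~` N) by exact: measurableC.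
rewrite (_ : _ `&` _ =
    \bigcup_(q : rat) (if ratr q <= a then ~` N `&` F (i, q) else set0)).
  apply: bigcupT_measurable_rat => q; case: ifP => // _.
  by apply: measurableI => //; case: (FP (i, q)).
apply/seteqP; split => x /=.
  rewrite in_itv/= => -[Nx hxa]; have [q] := rat_in_itvoo hxa.
  rewrite in_itv/= => /andP[hq qa]; exists q => //; rewrite ltW//; split => //.
  have := contra_not (sN x) Nx => /contrapT/(_ (i, q))/= [+ _]; exact.
move=> [q _]; case: ifP => // qa [Nx Fx]; split => //.
rewrite in_itv/=; apply: lt_le_trans qa.
by have := contra_not (sN x) Nx => /contrapT/(_ (i, q))/= [_]; exact.
Qed.

End BorelVersion.

(** * The inclusion in the tangent bundle *)

Theorem theorem5p5 (R : realType) (d : nat)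
    (mu : {measure set (borel_rV R d) -> \bar R}) (mu_radon : radon mu)
    (W : 'rV[R]_d -> {vspace 'rV[R]_d}) (W_meas : gr_measurable mu W)
    (W_diff : forall u : 'rV[R]_d -> R, lipschitz u ->
       {ae mu, forall x, differentiable_along u x (W x)})
    (T : 'rV[R]_d -> {vspace 'rV[R]_d}) (T_MK : MK_tangent_bundle mu T) :
  {ae mu, forall x, (W x <= T x)%VS}.
Proof.
pose e (i : 'I_d) : 'rV[R]_d := delta_mx 0 i.
have e1 i : dot (e i) (e i) <= 1 by rewrite dot_delta.
have [N [mN N0 mproj]] := @borel_version R d mu ('I_d * 'I_d)%type
  (fun p x => proj (W x) (e p.1) 0 p.2)
  (fun p a => W_meas _ (@proj_coord_open R d (e p.1) p.2 a (e1 p.1))).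
pose E n : set (borel_rV R d) := ~` N `&` cball n%:R.
have mE n : measurable (E n).
  by apply: measurableI; [exact: measurableC|exact: cball_measurable].
pose sigma n i (x : 'rV[R]_d) : 'rV[R]_d := if x \in E n then proj (W x) (e i) else 0.
have sigmaT n i : {ae mu, forall x, sigma n i x \in T x}.
  have meas j : measurable_fun setT (fun x : borel_rV R d => sigma n i x 0 j).
    rewrite (_ : (fun x => _) = (fun x => proj (W x) (e i) 0 j) \_ (E n)).
      have mp : measurable_fun (E n) (fun x : borel_rV R d => proj (W x) (e i) 0 j).
        refine (measurable_funS (measurableC mN) _ (mproj (i, j))).
        exact: subIsetl.
      exact: (measurable_restrictT _ (mE n)).1 mp.
    by apply/funext => x; rewrite patchE /sigma; case: ifP => // _; rewrite mxE.
  have le1 x : `|sigma n i x| <= 1.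
    rewrite /sigma; case: ifP => _; last by rewrite normr0.
    by apply: norm_le1_of_dot; apply: le_trans (proj_dot_le _ _) (e1 i).
  have out x : ~ cball n%:R x -> sigma n i x = 0.
    by move=> nx; rewrite /sigma; case: ifPn => //; rewrite inE => -[].
  have inW x : sigma n i x \in W x.
    rewrite /sigma; case: ifP => _; last exact: mem0v.
    by case: (projP (W x) (e i)).
  have fin : (mu (cball n%:R : set (borel_rV R d)) < +oo)%E.
    by apply: mu_radon.1; exact: cball_compact.
  have tan := bounded_field_tangent fin meas le1 out (aeW mu inW) W_diff.
  have [_ TP] := T_MK; exact/(TP _ tan.1).1.
have := @ae_forall_countable R d mu (nat * 'I_d)%type
  (fun p x => sigma p.1 p.2 x \in T x) (fun p => sigmaT p.1 p.2).
have notN : {ae mu, forall x, ~ N x}.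
  by exists N; split => // x /= /contrapT.
move=> sT; refine (ae_mono2 _ sT notN) => x {}sT Nx; apply: subv_of_proj => i.
have [n xn] : exists n : nat, `|x| <= n%:R.
  by exists (Num.bound `|x|); apply: ltW; exact: archi_boundP.
have := sT (n, i); rewrite /sigma /= ifT//.
by rewrite inE; split.
Qed.
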